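(* Let $n\ge1$, $\Sigma$ a finite set with $m=|\Sigma|$, a total order $<$ on $\Sigma$ and a distinguished element $\bar\sigma\in\Sigma$. In the subposet of $\Pi_{n,\Sigma}$ of type $B_n$, $C_n$ or $D_n$, equipped with the restriction of the labeling $\lambda$, the number of decreasing maximal chains from $\hat0$ to $\hat1$ equals $$\sum_{\pi=\pi_1\mid\cdots\mid\pi_k\in\Pi_n} f(\pi)\,(2|\pi_1|-3)!!\cdots(2|\pi_k|-3)!!,$$ where, writing $k$ for the number of blocks of $\pi$ and $s$ for the number of blocks of $\pi$ with at least two elements: Type $C_n$: $f(\pi)=\frac{(k+m-2)!}{(m-2)!}$ (and $f(\pi)=0$ if $m=1$). Type $D_n$: $f(\pi)=\sum_{r=2}^{\min(m,s)}\binom mr\frac{(k-2)!}{(r-2)!}\frac{s!}{(s-r)!}$ if $\pi\ne[n]$, and $f([n])=m-1$. Type $B_n$: $f(\pi)=\sum_{r=2}^{\min(m,s+1)}\binom{m-1}{r-1}\frac{(k-2)!}{(r-2)!}(k-r+1)\frac{s!}{(s-r+1)!}+\sum_{r=2}^{\min(m-1,s)}\binom{m-1}{r}\frac{(k-2)!}{(r-2)!}\frac{s!}{(s-r)!}$ if $\pi\ne[n]$, and $f([n])=m-1$.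
   Context: $[n]=\{1,\dots,n\}$, $[[n]]=\{1,\bar1,\dots,n,\bar n\}$ with involution $i\leftrightarrow\bar i$, $\bar X=\{\bar x:x\in X\}$. A $\Sigma$-labeled partition of $[[n]]$: a set partition $\pi$ of $[[n]]$ with a set $T\subseteq\pi$ of signed blocks and an injection $f:T\to\Sigma$, such that each block $R$ has $\bar R$ also a block, and $S=\bar S$ iff $S$ is signed. $\Sigma(\pi)=f(T)$, $\pi_\sigma$ = block of sign $\sigma$ ($\emptyset$ if $\sigma\notin\Sigma(\pi)$). Order: $\pi\preceq\psi$ iff $\pi_\sigma\subseteq\psi_\sigma$ for all $\sigma\in\Sigma(\pi)$ and each unsigned block $R$ of $\pi$ has a block $T$ of $\psi$ with $R\subseteq T$, $\bar R\subseteq\bar T$. $\Pi_{n,\Sigma}$: all such partitions plus a new maximum $\hat1$; $\hat0$ is the partition into singletons; rank $n-k$ ($k$ = number of pairs of unsigned blocks), $\mathrm{rk}(\hat1)=n+1$. Type $C_n$ subposet: $\Pi_{n,\Sigma}$; type $B_n$: $\hat1$ and all $x\ne\hat1$ with $|x_\sigma|\ne2$ for $\sigma\ne\bar\sigma$; type $D_n$: $\hat1$ and all $x\ne\hat1$ with $|x_\sigma|\ne2$ for all $\sigma$. These are ranked with the induced rank, so their covers are covers of $\Pi_{n,\Sigma}$. Labeling $\lambda$ of covers $x\prec\!\cdot\,y$: representative $r(R)$ of a block = least $i\in[n]$ with $i$ or $\bar i$ in $R$; $R$ normalized if $r(R)\in R$. If $y\neq\hat1$: if $R\cup R'\in y$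 for distinct normalized unsigned blocks $R,R'$ of $x$ (coherent), $\lambda=(0,\max(r(R),r(R')))$; if $R\cup\bar{R'}\in y$ for such $R,R'$ (non-coherent), $\lambda=(2,\min(r(R),r(R')))$; if $x_\sigma\subsetneq y_\sigma$ (edge of sign $\sigma$), $\lambda=(1,|\{\tau\in\Sigma(x):\tau\le\sigma\}|)$ when $\sigma\in\Sigma(x)$ and $\lambda=(1,|\{\tau\in\Sigma:\tau\le\sigma\}\cup\Sigma(x)|)$ otherwise. Finally $\lambda(x\prec\!\cdot\,\hat1)=(1,2)$. Labels are ordered lexicographically. A maximal chain is decreasing if its sequence of labels (read from bottom to top) is weakly decreasing. $\Pi_n$ is the set of set partitions of $[n]$; $[n]$ denotes the one-block partition. Convention: $(-1)!!=1$.
   Formalization: In types B_n and D_n the formal statement assumes n≥2 (type C_n keeps n≥1), since for n=1 the formula fails there: D_1 has exactly one decreasing maximal chain and B_1 at most one, while f([1])=m-1. *)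

(* Defs.v *)
From HB Require Import structures.
From mathcomp Require Import all_boot all_order all_algebra.

Set Implicit Arguments.
Unset Strict Implicit.
Unset Printing Implicit Defensive.

Import Order.TTheory GRing.Theory Num.Theory.

(* The pair (i, false) stands for the element i+1 of [n] and (i, true) for its
   barred copy. *)
Definition dbl (n : nat) : finType := ('I_n * bool)%type.

Definition barE (n : nat) (e : dbl n) : dbl n := (e.1, ~~ e.2).

Definition bar (n : nat) (R : {set dbl n}) : {set dbl n} :=
  [set barE e | e in R].

(* A labeled partition is a pair (P, f): P is the underlying set partition and
   f the partial labeling of the blocks, T being the set where f is defined. *)
Definition lpart_data (n : nat) (Sigma : finType) : finType :=
  ({set {set dbl n}} * {ffun {set dbl n} -> option Sigma})%type.

Definition is_lpart (n : nat) (Sigma : finType) (x : lpart_data n Sigma) : bool :=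
  let: (P, f) := x in
  [&& partition P [set: dbl n],
      [forall R, f R ==> (R \in P)],
      [forall R, forall S, (f R && (f R == f S)) ==> (R == S)],
      [forall R in P, bar R \in P] &
      [forall R in P, (R == bar R) == (f R : bool)]].

Definition lpart (n : nat) (Sigma : finType) : finType :=
  {x : lpart_data n Sigma | is_lpart x}.

Section LabeledPartitions.
Context {n : nat} {Sigma : finType}.
Implicit Types x y : lpart n Sigma.

Definition blocks x : {set {set dbl n}} := (val x).1.

Definition sign_of x (R : {set dbl n}) : option Sigma := (val x).2 R.

Definition unsigned x (R : {set dbl n}) : bool :=
  (R \in blocks x) && ~~ sign_of x R.

Definition signs x : {set Sigma} :=
  [set s | [exists R, sign_of x R == Some s]].

Definition sblock x (s : Sigma) : {set dbl n} :=
  odflt set0 [pick R | sign_of x R == Some s].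

Definition lpart_le x y : bool :=
  [forall s in signs x, sblock x s \subset sblock y s] &&
  [forall (R | unsigned x R), exists T in blocks y,
     (R \subset T) && (bar R \subset bar T)].

Definition singletons : lpart_data n Sigma :=
  ([set [set e] | e : dbl n], [ffun => None]).

Lemma singletonsP : is_lpart singletons.
Proof.
apply/and5P; split.
- apply/and3P; split.
  + rewrite eqEsubset subsetT /=; apply/subsetP => e _.
    by apply/bigcupP; exists [set e]; rewrite ?set11 ?imset_f.
  + apply/trivIsetP => _ _ /imsetP[e _ ->] /imsetP[e' _ ->] ne.
    by rewrite disjoints1 inE; apply: contra ne => /eqP ->.
  + by apply/imsetP => -[e _ /setP/(_ e)]; rewrite !inE eqxx.
- by apply/forallP => R; rewrite ffunE.
- by apply/forallP => R; apply/forallP => S; rewrite ffunE.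
- apply/forall_inP => _ /imsetP[e _ ->].
  by rewrite /bar imset_set1 imset_f.
- apply/forall_inP => _ /imsetP[[i b] _ ->]; rewrite ffunE /=.
  apply/eqP/negbTE/eqP => /setP/(_ (i, b)).
  by rewrite /bar imset_set1 !inE eqxx xpair_eqE eqxx; case: b.
Qed.

Definition lpart0 : lpart n Sigma := exist _ singletons singletonsP.

End LabeledPartitions.

(* None is the added maximum. *)
Definition lposet (n : nat) (Sigma : finType) : finType := option (lpart n Sigma).

Definition hat0 {n : nat} {Sigma : finType} : lposet n Sigma := Some lpart0.
Definition hat1 {n : nat} {Sigma : finType} : lposet n Sigma := None.

Definition lposet_le (n : nat) (Sigma : finType) (x y : lposet n Sigma) : bool :=
  match x, y with
  | _, None => true
  | None, Some _ => false
  | Some p, Some q => lpart_le p q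
  end.

Variant root_type := TypeB | TypeC | TypeD.

Definition in_type (n : nat) (Sigma : finType) (t : root_type) (sbar : Sigma)
    (x : lposet n Sigma) : bool :=
  match x, t with
  | None, _ | _, TypeC => true
  | Some p, TypeB => [forall s, (s != sbar) ==> (#|sblock p s| != 2)]
  | Some p, TypeD => [forall s, #|sblock p s| != 2]
  end.

Definition lposet_lt (n : nat) (Sigma : finType) (x y : lposet n Sigma) : bool :=
  (x != y) && lposet_le x y.

Definition covers (n : nat) (Sigma : finType) (t : root_type) (sbar : Sigma)
    (x y : lposet n Sigma) : bool :=
  [&& in_type t sbar x, in_type t sbar y, lposet_lt x y &
      [forall (z | in_type t sbar z), ~~ (lposet_lt x z && lposet_lt z y)]].

Definition rep (n : nat) (R : {set dbl n}) : nat :=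
  \big[minn/n.+1]_(i < n | ((i, false) \in R) || ((i, true) \in R)) i.+1.

Definition normalized (n : nat) (R : {set dbl n}) : bool :=
  [exists i : 'I_n, (i.+1 == rep R) && ((i, false) \in R)].

Definition coherent (n : nat) (Sigma : finType) (p q : lpart n Sigma)
    (R R' : {set dbl n}) : bool :=
  [&& unsigned p R, unsigned p R', normalized R, normalized R', R != R' &
      R :|: R' \in blocks q].

Definition noncoherent (n : nat) (Sigma : finType) (p q : lpart n Sigma)
    (R R' : {set dbl n}) : bool :=
  [&& unsigned p R, unsigned p R', normalized R, normalized R', R != R' &
      R :|: bar R' \in blocks q].

Definition sign_label (d : Order.disp_t) (n : nat) (Sigma : finOrderType d)
    (p : lpart n Sigma) (s : Sigma) : nat *l nat :=
  if s \in signs p then (1, #|[set u in signs p | (u <= s)%O]|)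
  else (1, #|[set u | (u <= s)%O] :|: signs p|).

(* Only meaningful when y covers x: then exactly one of the cases below applies
   and the label does not depend on the blocks or the sign that are picked.
   The final (0, 0) is a dummy value. *)
Definition label (d : Order.disp_t) (n : nat) (Sigma : finOrderType d)
    (x y : lposet n Sigma) : nat *l nat :=
  match x, y with
  | Some p, Some q =>
      if [pick RR : {set dbl n} * {set dbl n} | coherent p q RR.1 RR.2] is Some RR
      then (0, maxn (rep RR.1) (rep RR.2))
      else if [pick RR : {set dbl n} * {set dbl n} | noncoherent p q RR.1 RR.2]
        is Some RR
      then (2, minn (rep RR.1) (rep RR.2))
      else if [pick s | sblock p s \proper sblock q s] is Some s
      then sign_label p s
      else (0, 0)
  | _, _ => (1, 2)
  end.

Definition maximal_chain (n : nat) (Sigma : finType) (t : root_type)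
    (sbar : Sigma) (c : seq (lposet n Sigma)) : bool :=
  if c is x :: c' then
    [&& x == hat0, path (covers t sbar) x c' & last x c' == hat1]
  else false.

Definition label_seq (d : Order.disp_t) (n : nat) (Sigma : finOrderType d)
    (c : seq (lposet n Sigma)) : seq (nat *l nat) :=
  if c is x :: c' then pairmap (@label d n Sigma) x c' else [::].

Definition decreasing (d : Order.disp_t) (n : nat) (Sigma : finOrderType d)
    (c : seq (lposet n Sigma)) : bool :=
  sorted (fun a b : nat *l nat => (b <= a)%O) (label_seq c).

(* The bound on the length loses nothing, see size_maximal_chain below. *)
Definition decreasing_maximal_chains (d : Order.disp_t) (n : nat)
    (Sigma : finOrderType d) (t : root_type) (sbar : Sigma) :
    {set #|lposet n Sigma|.-bseq (lposet n Sigma)} :=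
  [set c : #|lposet n Sigma|.-bseq (lposet n Sigma) |
     maximal_chain t sbar c && decreasing c].

Fixpoint dfact (k : nat) : nat :=
  if k is k'.+2 then k * dfact k' else 1.

(* Only the value at -1 matters among negative arguments. *)
Definition dfactz (z : int) : nat :=
  match z with Posz k => dfact k | Negz _ => 1 end.

Local Open Scope ring_scope.

Definition fC (m k : nat) : rat :=
  if m == 1%N then 0 else ((k + m - 2)`!)%:R / ((m - 2)`!)%:R.

(* In the two sums below k >= max(2, s), so no subtraction truncates; k - r + 1
   and s - r + 1 are written k.+1 - r and s.+1 - r since r may be s + 1. *)
Definition fD_sum (m k s : nat) : rat :=
  \sum_(2 <= r < (minn m s).+1)
     'C(m, r)%:R * (((k - 2)`!)%:R / ((r - 2)`!)%:R)
       * ((s`!)%:R / ((s - r)`!)%:R).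

Definition fB_sum (m k s : nat) : rat :=
  \sum_(2 <= r < (minn m s.+1).+1)
     'C(m - 1, r - 1)%:R * (((k - 2)`!)%:R / ((r - 2)`!)%:R)
       * (k.+1 - r)%:R * ((s`!)%:R / ((s.+1 - r)`!)%:R)
  + \sum_(2 <= r < (minn (m - 1) s).+1)
     'C(m - 1, r)%:R * (((k - 2)`!)%:R / ((r - 2)`!)%:R)
       * ((s`!)%:R / ((s - r)`!)%:R).

Definition fpart (t : root_type) (m n : nat) (p : {set {set 'I_n}}) : rat :=
  let k := #|p| in
  let s := #|[set B in p | (2 <= #|B|)%N]| in
  match t with
  | TypeC => fC m k
  | TypeD => if p == [set [set: 'I_n]] then m%:R - 1 else fD_sum m k s
  | TypeB => if p == [set [set: 'I_n]] then m%:R - 1 else fB_sum m k s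
  end.

Local Close Scope ring_scope.

Section OrderFacts.
Context {n : nat} {Sigma : finType}.
Implicit Types x y z : lpart n Sigma.

Lemma barK : involutive (@bar n).
Proof.
move=> R; rewrite /bar -imset_comp -[RHS]imset_id.
by apply: eq_imset => -[i b]; rewrite /barE /= negbK.
Qed.

Lemma lpart_inv x :
  [/\ partition (blocks x) [set: dbl n],
      forall R, sign_of x R -> R \in blocks x,
      forall R S, sign_of x R -> sign_of x R = sign_of x S -> R = S,
      forall R, R \in blocks x -> bar R \in blocks x &
      forall R, R \in blocks x -> (R == bar R) = (sign_of x R : bool)].
Proof.
rewrite /blocks /sign_of; case: x => -[P f] /= /and5P[h1 h2 h3 h4 h5]; split=> //.
- by move=> R fR; apply: (implyP (forallP h2 R)).
- move=> R S fR eRS; apply/eqP.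
  by move/forallP/(_ R)/forallP/(_ S)/implyP: h3; apply; rewrite fR eRS eqxx.
- exact/forall_inP.
- by move=> R RP; have /eqP := forall_inP h5 R RP.
Qed.

Lemma sblockE x R s : sign_of x R = Some s -> sblock x s = R.
Proof.
move=> e; have [_ _ inj _ _] := lpart_inv x; rewrite /sblock.
case: pickP => [S /eqP eS|/(_ R)]; last by rewrite e eqxx.
by apply: inj; rewrite ?eS ?e.
Qed.

Lemma mem_signs x R s : sign_of x R = Some s -> s \in signs x.
Proof. by move=> e; rewrite inE; apply/existsP; exists R; apply/eqP. Qed.

Lemma lpart_leP x y : reflect
  ((forall R s, sign_of x R = Some s ->
     exists2 T, sign_of y T = Some s & R \subset T) /\
   (forall R, R \in blocks x -> exists2 T, T \in blocks y & R \subset T))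
  (lpart_le x y).
Proof.
have [px bx ix cx sx] := lpart_inv x; have [py by_ iy cy sy] := lpart_inv y.
apply: (iffP andP) => -[h1 h2].
  have h1' R s : sign_of x R = Some s ->
     exists2 T, sign_of y T = Some s & R \subset T.
    move=> e; move/forall_inP/(_ _ (mem_signs e)): h1; rewrite (sblockE e).
    rewrite /sblock; case: pickP => [T /eqP eT|_] sub; first by exists T.
    have: R \in blocks x by apply: bx; rewrite e.
    case/and3P: px => _ _ /negP n0 Rx; case: n0.
    by move: sub; rewrite subset0 => /eqP <-.
  split=> // R Rx; case e: (sign_of x R) => [s|].
    by have [T eT sub] := h1' _ _ e; exists T => //; apply: by_; rewrite eT.
  move/forall_inP/(_ R): h2; rewrite /unsigned Rx e => /(_ isT).
  by case/exists_inP => T Ty /andP[sub _]; exists T.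
split.
  apply/forall_inP => s; rewrite inE => /existsP[R /eqP e].
  by have [T eT sub] := h1 _ _ e; rewrite (sblockE e) (sblockE eT).
apply/forall_inP => R /andP[Rx _]; have [T Ty sub] := h2 _ Rx.
by apply/exists_inP; exists T; rewrite // sub imsetS.
Qed.

Lemma lpart_le_refl : reflexive (@lpart_le n Sigma).
Proof. by move=> x; apply/lpart_leP; split=> R => [s e|Rx]; exists R. Qed.

Lemma lpart_le_trans : transitive (@lpart_le n Sigma).
Proof.
move=> y x z /lpart_leP[a1 a2] /lpart_leP[b1 b2]; apply/lpart_leP; split.
  move=> R s /a1[T /b1[U eU TU] RT]; exists U => //; exact: subset_trans TU.
move=> R /a2[T /b2[U Uz TU] RT]; exists U => //; exact: subset_trans TU.
Qed.

Lemma lpart_block_sub x R S :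
  R \in blocks x -> S \in blocks x -> R \subset S -> R = S.
Proof.
have [/and3P[_ tI n0] _ _ _ _] := lpart_inv x => Rx Sx RS.
apply/eqP; apply: contraTT (RS) => ne.
have := trivIsetP tI _ _ Rx Sx ne; apply: contraL => _.
have /set0Pn[e eR]: R != set0 by apply: contraNneq n0 => <-.
by apply/pred0Pn; exists e; rewrite /= eR (subsetP RS).
Qed.

Lemma lpart_le_anti : antisymmetric (@lpart_le n Sigma).
Proof.
have aux x y : lpart_le x y -> lpart_le y x ->
    (blocks x \subset blocks y) /\
    (forall R s, sign_of x R = Some s -> sign_of y R = Some s).
  move=> /lpart_leP[a1 a2] /lpart_leP[b1 b2].
  have [_ bx _ _ _] := lpart_inv x.
  split.
    apply/subsetP => R Rx; have [T Ty RT] := a2 _ Rx.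
    have [U Ux TU] := b2 _ Ty.
    have eRU := lpart_block_sub Rx Ux (subset_trans RT TU).
    suff -> : R = T by [].
    by apply/eqP; rewrite eqEsubset RT eRU TU.
  move=> R s e; have [T eT RT] := a1 _ _ e; have [U eU TU] := b1 _ _ eT.
  have Rx : R \in blocks x by apply: bx; rewrite e.
  have Ux : U \in blocks x by apply: bx; rewrite eU.
  have eRU := lpart_block_sub Rx Ux (subset_trans RT TU).
  suff -> : R = T by [].
  by apply/eqP; rewrite eqEsubset RT eRU TU.
move=> x y /andP[xy yx]; have [s1 f1] := aux _ _ xy yx.
have [s2 f2] := aux _ _ yx xy; apply: val_inj.
move: s1 s2 f1 f2; rewrite /blocks /sign_of.
case: (val x) (val y) => [P f] [Q g] /= s1 s2 f1 f2; congr pair.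
  by apply/eqP; rewrite eqEsubset s1.
apply/ffunP => R; case e: (f R) => [s|]; first by rewrite (f1 _ _ e).
by case e': (g R) => [s|//]; rewrite (f2 _ _ e') in e.
Qed.

Lemma lpart0_le x : lpart_le lpart0 x.
Proof.
have [/and3P[/eqP cov _ _] _ _ _ _] := lpart_inv x.
apply/lpart_leP; split=> [R s|R]; rewrite /sign_of /blocks /= ?ffunE //.
case/imsetP => e _ ->.
have /bigcupP[T Tx eT] : e \in cover (blocks x) by rewrite cov.
by exists T; rewrite ?sub1set.
Qed.

Lemma lposet_le_trans : transitive (@lposet_le n Sigma).
Proof. by move=> [y|] [x|] [z|] //=; apply: lpart_le_trans. Qed.

Lemma lposet_le_anti : antisymmetric (@lposet_le n Sigma).
Proof. by move=> [x|] [y|] //= /lpart_le_anti ->. Qed.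

Lemma lposet_lt_trans : transitive (@lposet_lt n Sigma).
Proof.
move=> y x z /andP[xy lxy] /andP[yz lyz].
rewrite /lposet_lt (lposet_le_trans lxy lyz) andbT.
apply: contraNneq xy => exz; apply/eqP/lposet_le_anti.
by rewrite lxy exz lyz.
Qed.

Lemma size_maximal_chain (t : root_type) (sbar : Sigma)
    (c : seq (lposet n Sigma)) :
  maximal_chain t sbar c -> size c <= #|lposet n Sigma|.
Proof.
case: c => // x c /and3P[_ pc _].
have : uniq (x :: c).
  apply: (@sorted_uniq _ (@lposet_lt n Sigma)); first exact: lposet_lt_trans.
    by move=> y; rewrite /lposet_lt eqxx.
  by apply: sub_path pc => y z /and4P[].
by move/card_uniqP => <-; apply: max_card.
Qed.

End OrderFacts.

(* Main.v *)
(* A partition x is encoded by the function sending i to its sign, or to the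
   representative r of its block together with the parity of i relative to r.
   In this encoding a cover x < y below the maximum is a move: one representative
   is attached either to a sign or to a smaller representative, so each cover
   removes exactly one representative.

   As the last label is (1, 2), a decreasing chain first performs non-coherent
   merges and then signs blocks.  In the first phase the representatives 1, .., n
   are treated from the largest to the smallest and each one collects a sequence
   of larger ones: this builds an increasing plane forest, and (2b - 3)!! counts
   the increasing plane trees on b nodes.  In the second phase the available
   labels at x are a bijection from Sigma to {1, .., m}, the labels at most
   |Sigma(x)| being those of the signs already present.  Hence r new signs are
   opened first, in decreasing order, and the other blocks follow a weakly
   decreasing sequence in {2, .., r}. *)
Require Import Defs.
From mathcomp Require Import all_boot all_order all_algebra.
From mathcomp Require Import zify ring.

Set Implicit Arguments.
Unset Strict Implicit.
Unset Printing Implicit Defensive.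
Import Order.TTheory GRing.Theory Num.Theory.

(** * Codes of labeled partitions *)

Section Codes.
Context {n : nat} {Sigma : finType}.
Implicit Types (x y z : lpart n Sigma) (e : dbl n) (i j r : 'I_n) (s : Sigma).

(** Decreasing chains are never exhibited: [cn x l] counts the ways to complete a chain at [x] with
    labels bounded by [l], and each phase rests on a family of bounds that the moves preserve and
    for which this number has a closed form. For signing the bound is [(1, #|below S| + #|S|)], with
    [S] the signs present and [below S] the signs smaller than all of them. For merging it is
    [(2, a)]: only representatives of index less than [a] still collect.

    Types B and D differ from C in that a single pair cannot open a sign (in type B, a sign other
    than [sbar]), while reusing an open sign is always allowed. So the signing count involves the
    number [s] of non-singletons and, in type B, whether [sbar] gets opened.

    The value at [[n]] is exceptional because the final label (1, 2) is compared with a label, not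
    with a number of open signs: when a single signing remains and no sign is open, its label may be
    anything in {2, .., m}. For [n = 1] in types B and D the only block is a single pair, which no
    sign but [sbar] in type B can take; at most one chain exists, whence [hBD]. *)

Definition code := {ffun 'I_n -> Sigma + 'I_n * bool}.
Implicit Types (h : code) (v : (Sigma + 'I_n * bool)%type).

Definition twist (b : bool) v : (Sigma + 'I_n * bool)%type :=
  match v with inl s => inl s | inr (r, c) => inr (r, b (+) c) end.

Definition ext h e : (Sigma + 'I_n * bool)%type := twist e.2 (h e.1).

Definition valid h : bool :=
  [forall i, if h i is inr (r, _) then (r <= i) && (h r == inr (r, false))
             else true].

Lemma twist0 v : twist false v = v.
Proof. by case: v => [s|[r []]]. Qed.

Lemma twistD a b v : twist a (twist b v) = twist (a (+) b) v.
Proof. by case: v => [s|[r c]] //=; rewrite addbA. Qed.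

Lemma twist_inj b : injective (twist b).
Proof.
by move=> u v /(congr1 (twist b)); rewrite !twistD addbb !twist0.
Qed.

Lemma twist_inl b v s : (twist b v == inl s) = (v == inl s).
Proof. by case: v => [s'|[r c]]. Qed.

Lemma ext_bar h e : ext h (barE e) = twist true (ext h e).
Proof. by rewrite /ext /barE twistD. Qed.

Lemma ext0 h i : ext h (i, false) = h i.
Proof. exact: twist0. Qed.

Lemma valid_root h i r b :
  valid h -> h i = inr (r, b) -> (r <= i) /\ h r = inr (r, false).
Proof. by move=> /forallP/(_ i); move=> + e; rewrite e => /andP[-> /eqP]. Qed.

Lemma valid_ext h e r b :
  valid h -> ext h e = inr (r, b) -> (r <= e.1) /\ ext h (r, b) = inr (r, b).
Proof.
move=> vh; rewrite /ext /=; case E: (h e.1) => [s|[r' c]] //= [<- _].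
have [le e'] := valid_root vh E; split=> //.
by rewrite e' /= addbF.
Qed.

(** Equal kernels put the two representatives of a class in each other's class, so each is at most
    the other. The relative bar is then forced, since [ext h] commutes with the bar and separates a
    representative from its barred copy. *)
Lemma code_uniq h h' : valid h -> valid h' ->
  (forall e e', (ext h e == ext h e') = (ext h' e == ext h' e')) ->
  (forall e s, (ext h e == inl s) = (ext h' e == inl s)) -> h = h'.
Proof.
move=> vh vh' ee es; apply/ffunP => i; rewrite -!(ext0 _ i).
case E: (ext h (i, false)) => [s|[r b]].
  by apply/esym/eqP; rewrite -es E.
case E': (ext h' (i, false)) => [s|[r' b']].
  by move: (es (i, false) s); rewrite E E' eqxx.
have [le1 e1] := valid_ext vh E; have [le2 e2] := valid_ext vh' E'.
have e3 : ext h' (r, b) = inr (r', b').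
  by apply/eqP; rewrite -E' -ee e1 E.
have e4 : ext h (r', b') = inr (r, b).
  by apply/eqP; rewrite -E ee e2 E'.
have [le3 _] := valid_ext vh' e3; have [le4 _] := valid_ext vh e4.
have er : r = r' by apply/val_inj/anti_leq; rewrite le3 le4.
subst r'; case: (b =P b') => [->//|/eqP nb].
have bb : (r, b') = barE (r, b).
  by rewrite /barE /=; case: b b' nb {E E' e1 e2 e3 e4 le3 le4} => [] [].
by move: e4; rewrite bb ext_bar e1 /=; case; case: (b).
Qed.

Definition blk x e := pblock (blocks x) e.

Lemma blk_in x e : blk x e \in blocks x.
Proof.
have [/and3P[/eqP cov _ _] _ _ _ _] := lpart_inv x.
by apply: pblock_mem; rewrite cov.
Qed.

Lemma mem_blk_id x e : e \in blk x e.
Proof.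
have [/and3P[/eqP cov _ _] _ _ _ _] := lpart_inv x.
by rewrite mem_pblock cov.
Qed.

Lemma blkE x R e : R \in blocks x -> e \in R -> blk x e = R.
Proof.
have [/and3P[_ tI _] _ _ _ _] := lpart_inv x.
by move=> Rx eR; apply: def_pblock.
Qed.

Lemma mem_blk x e e' : (e' \in blk x e) = (blk x e' == blk x e).
Proof.
apply/idP/eqP => [e'b|<-]; last exact: mem_blk_id.
exact: blkE (blk_in x e) e'b.
Qed.

Lemma barEK : involutive (@barE n).
Proof. by move=> [i b]; rewrite /barE /= negbK. Qed.

Lemma mem_bar (R : {set dbl n}) e : (e \in bar R) = (barE e \in R).
Proof.
apply/imsetP/idP => [[e' e'R ->]|eR]; first by rewrite barEK.
by exists (barE e); rewrite ?barEK.
Qed.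

Lemma bar_blk x e : bar (blk x e) = blk x (barE e).
Proof.
have [_ _ _ cx _] := lpart_inv x.
apply/esym/blkE; first exact/cx/blk_in.
by rewrite mem_bar barEK mem_blk_id.
Qed.

Lemma sign_blk x e : (blk x e == blk x (barE e)) = (sign_of x (blk x e) : bool).
Proof.
by have [_ _ _ _ sx] := lpart_inv x; rewrite -sx ?blk_in // bar_blk.
Qed.

Lemma block_blk x R : R \in blocks x -> exists e, R = blk x e.
Proof.
have [/and3P[_ _ n0] _ _ _ _] := lpart_inv x => Rx.
have /set0Pn[e eR] : R != set0 by apply: contraNneq n0 => <-.
by exists e; rewrite (blkE Rx eR).
Qed.

(** An unsigned block is disjoint from its bar, so exactly one of [(r, false)] and [(r, true)] lies
    in it; the boolean records which one. *)
Definition cd x : code := [ffun i =>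
  match sign_of x (blk x (i, false)) with
  | Some s => inl s
  | None =>
    let r := [arg min_(j < i | ((j, false) \in blk x (i, false))
                               || ((j, true) \in blk x (i, false))) j] in
    inr (r, (r, true) \in blk x (i, false))
  end].

Lemma sign_of_bar x e : sign_of x (blk x (barE e)) = sign_of x (blk x e).
Proof.
have [/eqP->//|ne] := boolP (blk x e == blk x (barE e)).
move: (sign_blk x e) (sign_blk x (barE e)).
rewrite barEK [_ (barE e) == _]eq_sym (negbTE ne).
by case: (sign_of x _); case: (sign_of x _).
Qed.

Lemma ext_cd_sign x e s :
  (ext (cd x) e == inl s) = (sign_of x (blk x e) == Some s).
Proof.
case: e => i c; rewrite /ext twist_inl ffunE /=.
have -> : sign_of x (blk x (i, c)) = sign_of x (blk x (i, false)).
  by case: c => //; rewrite -[(i, true)]/(barE (i, false)) sign_of_bar.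
by case: (sign_of x _).
Qed.

Lemma ext_cd_unsigned x e r b : ext (cd x) e = inr (r, b) ->
  [/\ sign_of x (blk x e) = None, (r, b) \in blk x e &
      forall j c, (j, c) \in blk x e -> r <= j].
Proof.
move=> E; have S0 : sign_of x (blk x e) = None.
  case S: (sign_of x _) => [s|//].
  by move/eqP: S; rewrite -ext_cd_sign E.
suff W i r' b' : cd x i = inr (r', b') ->
    (r', b') \in blk x (i, false) /\
    (forall j c, (j, c) \in blk x (i, false) -> r' <= j).
  split=> //.
    case: e E S0 => i c; rewrite /ext /=; case E': (cd x i) => [s|[r' b']] //=.
    case=> <- <- _; have [mb _] := W _ _ _ E'.
    case: c => //=; rewrite -[(i, true)]/(barE (i, false)) -bar_blk mem_bar.
    by rewrite /barE /= negbK.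
  case: e E S0 => i c; rewrite /ext /=; case E': (cd x i) => [s|[r' b']] //=.
  case=> <- _ _; have [_ mb] := W _ _ _ E'.
  move=> j d; case: c => //=; last exact: mb.
  rewrite -[(i, true)]/(barE (i, false)) -bar_blk mem_bar; exact: mb.
rewrite ffunE; case S: (sign_of x _) => [s|] //= -[].
case: arg_minnP => [|r0 r0P r0min] /=; first by rewrite mem_blk_id.
move=> <- <-; split; last first.
  move=> j c jc; apply: r0min; case: c jc => ->; rewrite ?orbT //.
by move: r0P; case E2: ((r0, true) \in blk x (i, false)); rewrite ?E2 ?orbF.
Qed.

Lemma ext_cd_eq x e e' :
  (ext (cd x) e == ext (cd x) e') = (blk x e == blk x e').
Proof.
case E: (ext (cd x) e) => [s|[r b]].
  rewrite eq_sym ext_cd_sign.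
  move/eqP: E; rewrite ext_cd_sign => /eqP S.
  apply/eqP/eqP => [S'|<-//].
  by have [_ _ inj _ _] := lpart_inv x; apply: inj; rewrite S ?S'.
case E': (ext (cd x) e') => [s|[r' b']].
  move/eqP: E'; rewrite ext_cd_sign => /eqP S'.
  have [S _ _] := ext_cd_unsigned E.
  by apply/esym/negbTE/eqP => eb; rewrite eb S' in S.
have [S rb rmin] := ext_cd_unsigned E; have [S' rb' rmin'] := ext_cd_unsigned E'.
apply/eqP/eqP => [[er eb]|eb].
  move: rb rb'; rewrite er eb !mem_blk => /eqP<- /eqP<- //.
rewrite -eb in rb' rmin'.
have er : r = r' by apply/val_inj/anti_leq; rewrite (rmin _ _ rb') (rmin' _ _ rb).
subst r'; case: (b =P b') => [->//|/eqP nb].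
(* Opposite bars would put [r] and its barred copy into one block, which would then be its own bar
   and hence signed. *)
move: (sign_blk x e); rewrite S /= => /negbT/negP[].
have bb : (r, b') = barE (r, b).
  by rewrite /barE /=; case: (b) (b') nb => [] [].
move: rb rb'; rewrite bb !mem_blk => /eqP eq1 /eqP eq2.
by rewrite -(bar_blk x e) -eq1 bar_blk eq2 eq1.
Qed.

Lemma cd_valid x : valid (cd x).
Proof.
apply/forallP => i; case E: (cd x i) => [//|[r b]].
have E' : ext (cd x) (i, false) = inr (r, b) by rewrite ext0.
have [_ rb rmin] := ext_cd_unsigned E'.
rewrite (rmin i false (mem_blk_id _ _)) /=.
move: rb; rewrite mem_blk -ext_cd_eq E' /ext /=.
case: (cd x r) => [//|[r' b']] /=; case: (b) => /=; case: b' => //=.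
Qed.

Lemma mem_blk_ext x e e' : (e' \in blk x e) = (ext (cd x) e' == ext (cd x) e).
Proof. by rewrite mem_blk ext_cd_eq. Qed.

(* The code of [x] is transported to that of any [y] above [x] by sending a
   block of [x] to the block of [y] that contains its representative. *)
Definition act h v : (Sigma + 'I_n * bool)%type :=
  match v with inl s => inl s | inr (r, b) => twist b (h r) end.

Lemma act_twist h b v : act h (twist b v) = twist b (act h v).
Proof. by case: v => [s|[r c]] //=; rewrite twistD. Qed.

(** The inclusion of blocks says that [ext (cd y)] is constant on the blocks of [x]; it is therefore
    determined by its values at the representatives of [x], with bars carried along. *)
Lemma cd_le x y : lpart_le x y = [forall i, cd y i == act (cd y) (cd x i)].
Proof.
apply/lpart_leP/forallP => [[h1 h2] i|H].
  case E: (cd x i) => [s|[r b]] /=.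
    have : ext (cd x) (i, false) == inl s by rewrite ext0 E.
    rewrite ext_cd_sign => /eqP /h1[T eT sub].
    have bT : blk y (i, false) = T.
      apply: blkE; last exact: (subsetP sub _ (mem_blk_id _ _)).
      by have [_ by_ _ _ _] := lpart_inv y; apply: by_; rewrite eT.
    by rewrite -(ext0 (cd y)) ext_cd_sign bT eT.
  have [_ er] := valid_root (cd_valid x) E.
  have : (r, b) \in blk x (i, false).
    by rewrite mem_blk_ext ext0 E /ext /= er /= addbF.
  have [T Ty sub] := h2 _ (blk_in x (i, false)).
  move=> /(subsetP sub); rewrite -(blkE Ty (subsetP sub _ (mem_blk_id _ _))).
  by rewrite mem_blk_ext ext0 /ext /= => /eqP ->.
have H' e : ext (cd y) e = act (cd y) (ext (cd x) e).
  by rewrite /ext (eqP (H e.1)) -act_twist.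
split=> [R s eR|R Rx].
  have [e Re] : exists e, R = blk x e.
    by apply: block_blk; have [_ by_ _ _ _] := lpart_inv x; apply: by_; rewrite eR.
  exists (blk y e).
    apply/eqP; rewrite -ext_cd_sign H'; move/eqP: eR.
    by rewrite Re -ext_cd_sign => /eqP->.
  by apply/subsetP => e'; rewrite Re !mem_blk_ext !H' => /eqP->.
have [e Re] := block_blk Rx; exists (blk y e); first exact: blk_in.
by apply/subsetP => e'; rewrite Re !mem_blk_ext !H' => /eqP->.
Qed.

Lemma cd_leP x y :
  lpart_le x y <-> forall i, cd y i = act (cd y) (cd x i).
Proof.
rewrite cd_le; split=> [/forallP H i|H]; first exact/eqP.
by apply/forallP => i; apply/eqP.
Qed.

Lemma act_valid h i : valid h -> act h (h i) = h i.
Proof.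
move=> vh; case E: (h i) => [//|[r b]] /=.
by have [_ ->] := valid_root vh E; rewrite /= addbF.
Qed.

Lemma cd_inj : injective cd.
Proof.
move=> x y e; apply: lpart_le_anti; rewrite !cd_le e.
by rewrite andbb; apply/forallP => i; rewrite act_valid ?cd_valid.
Qed.

(** * Every valid code comes from a labeled partition *)

Section Decode.
Variable (h : code).
Hypothesis vh : valid h.

Definition ecls e : {set dbl n} := [set e' | ext h e' == ext h e].

Lemma bar_ecls e : bar (ecls e) = ecls (barE e).
Proof.
apply/setP => e'; rewrite mem_bar !inE !ext_bar.
by rewrite -[RHS](inj_eq (@twist_inj true)) twistD twist0.
Qed.

Lemma ecls_eq e e' : (ecls e == ecls e') = (ext h e == ext h e').
Proof.
apply/eqP/eqP => [/setP/(_ e)|ee]; first by rewrite !inE eqxx => /esym/eqP.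
by apply/setP => e0; rewrite !inE ee.
Qed.

(** The test [R != set0] matters: a sign that does not occur has an empty fibre, and the empty set
    must stay unlabeled because it is not a block. *)
Definition decode_data : lpart_data n Sigma :=
  ([set ecls e | e : dbl n],
   [ffun R => [pick s | (R != set0) && (R == [set e | ext h e == inl s])]]).

Lemma decode_sign e s :
  (decode_data.2 (ecls e) == Some s) = (ext h e == inl s).
Proof.
rewrite /= ffunE; case: pickP => [s' /andP[n0 /eqP E]|H].
  have : e \in ecls e by rewrite inE.
  by rewrite E inE => /eqP->; apply/eqP/eqP => [[->]|[->]].
apply/esym/negbTE/eqP => E; move: (H s) => /andP[]; split.
  by apply/set0Pn; exists e; rewrite inE.
by apply/eqP/setP => e'; rewrite !inE E.
Qed.

Lemma decodeP : is_lpart decode_data.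
Proof.
apply/and5P; split.
- apply/and3P; split.
  + rewrite eqEsubset subsetT /=; apply/subsetP => e _.
    by apply/bigcupP; exists (ecls e); rewrite ?imset_f ?inE.
  + apply/trivIsetP => _ _ /imsetP[e _ ->] /imsetP[e' _ ->] ne.
    apply/pred0P => e0 /=; rewrite !inE; apply: contraNF ne.
    by move=> /andP[/eqP e1 /eqP e2]; rewrite ecls_eq -e1 e2.
  + by apply/imsetP => -[e _ /setP/(_ e)]; rewrite !inE eqxx.
- apply/forallP => R; apply/implyP; rewrite ffunE.
  case: pickP => [s /andP[/set0Pn[e eR] /eqP E] _|//].
  apply/imsetP; exists e => //; apply/setP => e'.
  by move: eR; rewrite E !inE => /eqP->.
- apply/forallP => R; apply/forallP => S; apply/implyP; rewrite !ffunE.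
  case: pickP => [s /andP[_ /eqP->]|//].
  by case: pickP => [s' /andP[_ /eqP->]|//] /= /eqP[->].
- apply/forall_inP => _ /imsetP[e _ ->].
  by rewrite bar_ecls imset_f.
- apply/forall_inP => _ /imsetP[e _ ->]; rewrite bar_ecls ecls_eq ext_bar.
  have := decode_sign e; rewrite [decode_data.2]/=.
  case E: (ext h e) => [s|[r b]] DS.
    by move/(_ s): DS; rewrite eqxx => /eqP->; rewrite /= eqxx.
  case F: (_ (ecls e)) => [s|/=]; first by move: (DS s); rewrite F eqxx.
  by apply/eqP/negbTE/eqP => -[]; case: (b).
Qed.

Lemma decode_exists : exists x, cd x = h.
Proof.
pose x : lpart n Sigma := exist _ decode_data decodeP.
have be e : blk x e = ecls e.
  by apply: blkE; rewrite ?inE // /blocks imset_f.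
exists x; apply: code_uniq => //; first exact: cd_valid.
  by move=> e e'; rewrite ext_cd_eq !be ecls_eq.
by move=> e s; rewrite ext_cd_sign be -decode_sign.
Qed.

End Decode.

Definition decode h : lpart n Sigma := odflt lpart0 [pick x | cd x == h].

Lemma decodeK h : valid h -> cd (decode h) = h.
Proof.
move=> /decode_exists[x xh]; rewrite /decode.
by case: pickP => [y /eqP//|/(_ x)]; rewrite xh eqxx.
Qed.

Definition scls x s : {set 'I_n} := [set i | cd x i == inl s].
Definition rcls x r : {set 'I_n} :=
  [set i | if cd x i is inr (r', _) then r' == r else false].
Definition reps x : {set 'I_n} := [set r | cd x r == inr (r, false)].

Lemma mem_sblock x s e : (e \in sblock x s) = (cd x e.1 == inl s).
Proof.
rewrite -(twist_inl e.2) -[twist _ _]/(ext (cd x) e) ext_cd_sign /sblock.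
case: pickP => [R /eqP eR|H]; last by rewrite inE H.
have Rx : R \in blocks x.
  by have [_ bx _ _ _] := lpart_inv x; apply: bx; rewrite eR.
apply/idP/eqP => [eR'|E]; first by rewrite (blkE Rx eR').
have [_ _ inj _ _] := lpart_inv x.
by rewrite (inj R (blk x e)) ?eR ?E // mem_blk_id.
Qed.

Lemma card_sblock x s : #|sblock x s| = 2 * #|scls x s|.
Proof.
have -> : sblock x s = setX (scls x s) [set: bool].
  by apply/setP => e; rewrite mem_sblock !inE andbT.
by rewrite cardsX cardsT card_bool mulnC.
Qed.

Lemma mem_signsE x s : (s \in signs x) = [exists i, cd x i == inl s].
Proof.
rewrite inE; apply/existsP/existsP => [[R /eqP eR]|[i ei]].
  have [e Re] : exists e, R = blk x e.
    by apply: block_blk; have [_ bx _ _ _] := lpart_inv x; apply: bx; rewrite eR.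
  by exists e.1; rewrite -(twist_inl e.2) ext_cd_sign -Re eR.
by exists (blk x (i, false)); rewrite -ext_cd_sign ext0.
Qed.

Lemma signs_scls x s : (s \in signs x) = (0 < #|scls x s|).
Proof.
rewrite mem_signsE card_gt0; apply/existsP/set0Pn => -[i ei]; exists i.
  by rewrite inE.
by move: ei; rewrite inE.
Qed.

Lemma cd_root x i r b : cd x i = inr (r, b) -> r \in reps x.
Proof. by move=> E; have [_ er] := valid_root (cd_valid x) E; rewrite inE er. Qed.

Lemma mem_scls x s i : (i \in scls x s) = (cd x i == inl s).
Proof. by rewrite inE. Qed.

Lemma mem_rcls x r i :
  (i \in rcls x r) = if cd x i is inr (r', _) then r' == r else false.
Proof. by rewrite inE. Qed.

Lemma mem_reps x r : (r \in reps x) = (cd x r == inr (r, false)).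
Proof. by rewrite inE. Qed.

Definition clsE := (mem_scls, mem_rcls, mem_reps, inE).

End Codes.

(* Unification otherwise unfolds these down to the underlying finite sets. *)
Global Opaque cd decode blk lpart_le scls rcls reps.

(** * Moves and covers *)

Section Moves.
Context {n : nat} {Sigma : finType}.
Implicit Types (x y z : lpart n Sigma) (e : dbl n) (i j r : 'I_n) (s : Sigma).
Implicit Types (h : @code n Sigma) (v : (Sigma + 'I_n * bool)%type).

Lemma cd_rep x r : r \in reps x -> cd x r = inr (r, false).
Proof. by rewrite clsE => /eqP. Qed.

Lemma cd_rootP x i r b :
  cd x i = inr (r, b) -> (r <= i) /\ r \in reps x.
Proof.
move=> E; split; last exact: cd_root E.
by have [] := valid_root (cd_valid x) E.
Qed.

Lemma cd_root_eq x r b : cd x r = inr (r, b) -> b = false.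
Proof. by move=> E; move: (cd_root E); rewrite clsE E => /eqP[]. Qed.

Lemma reps_sub x y : lpart_le x y -> reps y \subset reps x.
Proof.
move=> /cd_leP le; apply/subsetP => r ry.
have er := cd_rep ry; move: (le r); rewrite er.
case E: (cd x r) => [s|[r' b]] /= E'; first discriminate.
have [le1 _] := cd_rootP E.
case E2: (cd y r') => [s|[r2 b2]]; rewrite E2 /= in E'; first discriminate.
case: E' => er2 _; have [le2 _] := cd_rootP E2.
have rr : r' = r by apply/val_inj/anti_leq; rewrite le1 er2 le2.
by move: E; rewrite rr => E; rewrite clsE E (cd_root_eq E).
Qed.

Lemma reps_eq x y : lpart_le x y -> reps x = reps y -> x = y.
Proof.
move=> /cd_leP le er; apply: cd_inj; apply/ffunP => i.
rewrite (le i); case E: (cd x i) => [//|[r b]] /=.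
have [_ rx] := cd_rootP E; rewrite er in rx.
by rewrite (cd_rep rx) /= addbF.
Qed.

(** The number of representatives is the number of pairs of unsigned blocks, so this strictness
    provides the grading: a move that loses one representative leaves no room for an element in
    between. *)
Lemma reps_proper x y : lpart_le x y -> x <> y -> reps y \proper reps x.
Proof.
move=> le ne; rewrite properEneq reps_sub // andbT.
by apply/eqP => e; apply: ne; exact: reps_eq.
Qed.

(* The move [(r, v)] attaches the block represented by [r] to the block
   described by [v]: a signed block if [v = inl s], the block represented by
   [r1] with a relative bar [b] if [v = inr (r1, b)]. *)
Definition mvcode h r v : @code n Sigma :=
  [ffun i => if h i is inr (r', c) then
               if r' == r then twist c v else h i
             else h i].

Lemma mvcodeE h r v i : mvcode h r v i =
  if h i is inr (r', c) then if r' == r then twist c v else h i else h i.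
Proof. exact: ffunE. Qed.

Definition mv x r v : lpart n Sigma := decode (mvcode (cd x) r v).

Definition mvok x r v : bool :=
  (r \in reps x) &&
  (if v is inr (r1, _) then (r1 \in reps x) && (r1 < r) else true).

Lemma cd_mv x r v : mvok x r v -> cd (mv x r v) = mvcode (cd x) r v.
Proof.
case/andP=> rx vx; apply: decodeK; apply/forallP => i; rewrite !mvcodeE.
case E: (cd x i) => [s|[r' c]] //=.
have [le1 r'x] := cd_rootP E.
case: eqVneq => [er|ne].
  case: v vx => [//|[r1 b]] /= /andP[r1x lt1]; rewrite mvcodeE (cd_rep r1x).
  rewrite ifN ?eqxx ?andbT; first by rewrite -er in lt1; lia.
  by rewrite neq_ltn lt1.
by rewrite le1 mvcodeE (cd_rep r'x) (negbTE ne) eqxx.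
Qed.

Opaque mv.

Section MoveFacts.
Variables (x : lpart n Sigma) (r : 'I_n) (v : (Sigma + 'I_n * bool)%type).
Hypothesis ok : mvok x r v.
Let z := mv x r v.

Lemma mv_root : cd z r = v.
Proof.
case/andP: (ok) => rx _.
by rewrite /z cd_mv // mvcodeE (cd_rep rx) eqxx twist0.
Qed.

Lemma mv_reps : reps z = reps x :\ r.
Proof.
case/andP: (ok) => rx vx; apply/setP => i; rewrite !clsE.
case: (eqVneq i r) => [->|ne].
  rewrite mv_root /=; apply/negbTE/eqP => E; move: vx; rewrite E.
  by rewrite ltnn andbF.
rewrite /z cd_mv // mvcodeE; case E: (cd x i) => [s|[r' c]] //=.
have [le1 r'x] := cd_rootP E.
case: (eqVneq r' r) => [er|//]; apply/eqP/eqP.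
  case: v vx => [//|[r1 b]] /= /andP[_ lt1] [er1 _].
  by rewrite er -er1 in le1; lia.
by case=> eri _; rewrite -eri er eqxx in ne.
Qed.

Lemma card_mv_reps : #|reps x| = #|reps z|.+1.
Proof. by case/andP: (ok) => rx _; rewrite mv_reps (cardsD1 r) rx. Qed.

Lemma mv_ge : lpart_le x z.
Proof.
apply/cd_leP => i.
case E: (cd x i) => [s|[r' c]] /=; first by rewrite /z cd_mv // mvcodeE E.
have [le1 r'x] := cd_rootP E.
rewrite /z cd_mv // !mvcodeE E (cd_rep r'x); case: (r' == r) => /=.
  by rewrite twist0.
by rewrite addbF.
Qed.

Lemma mv_neq : x <> z.
Proof.
move=> e; move: card_mv_reps; rewrite -e => /eqP.
by rewrite -[X in X == _]addn0 -addn1 eqn_add2l.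
Qed.

Lemma mv_le y : lpart_le x y -> cd y r = act (cd y) v -> lpart_le z y.
Proof.
move=> /cd_leP le er; apply/cd_leP => i.
rewrite /z cd_mv // !mvcodeE (le i); case E: (cd x i) => [s|[r' c]] //=.
by case: (r' =P r) => [->|//]; rewrite er act_twist.
Qed.

Lemma mv_scls s :
  scls z s = if v == inl s then scls x s :|: rcls x r else scls x s.
Proof.
apply/setP => i; rewrite /z clsE cd_mv // mvcodeE.
case: (boolP (v == inl s)) => vs; rewrite !clsE;
  case E: (cd x i) => [s'|[r' c]] //=; rewrite ?orbF //;
  by case: (r' =P r) => //= _; rewrite twist_inl ?vs // (negbTE vs).
Qed.

Lemma mv_rcls_sg s r' : v = inl s -> r' != r -> rcls z r' = rcls x r'.
Proof.
move=> vs ne; apply/setP => i; rewrite /z !clsE cd_mv // mvcodeE vs.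
case E: (cd x i) => [s'|[r2 c]] //=.
by case: (r2 =P r) => [->|//]; rewrite eq_sym (negbTE ne).
Qed.

Lemma mv_signs s : v = inl s -> signs z = s |: signs x.
Proof.
move=> vs; case/andP: (ok) => rx _.
apply/setP => s'; rewrite in_setU1 !signs_scls mv_scls vs.
case: (eqVneq s' s) => [->|ne].
  rewrite eqxx card_gt0; apply/set0Pn; exists r.
  by rewrite !clsE (cd_rep rx) eqxx orbT.
case: eqP => [[e]|_ //]; by rewrite e eqxx in ne.
Qed.

Lemma mv_signs_mg p : v = inr p -> signs z = signs x.
Proof. by move=> vs; apply/setP => s'; rewrite !signs_scls mv_scls vs. Qed.

End MoveFacts.

Lemma mv_inj x r v r' v' : mvok x r v -> mvok x r' v' ->
  mv x r v = mv x r' v' -> (r, v) = (r', v').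
Proof.
move=> ok ok' e.
have er : r = r'.
  case/andP: (ok) => rx _; move: (mv_reps ok).
  rewrite e (mv_reps ok') => /setP/(_ r); rewrite !clsE eqxx /=.
  by move: rx; rewrite clsE => ->; rewrite andbT => /negbFE/eqP.
by rewrite er in ok e *; rewrite -(mv_root ok) e (mv_root ok').
Qed.

(** * Covers in types B, C and D *)

Section Types.
Variables (t : root_type) (sbar : Sigma).

(* The signs whose block may not consist of a single pair [i, bar i]. *)
Definition forb s : bool :=
  match t with TypeB => s != sbar | TypeC => false | TypeD => true end.

Definition itp x : bool := [forall s, forb s ==> (#|scls x s| != 1)].

Lemma in_typeE x : in_type t sbar (Some x) = itp x.
Proof.
rewrite /in_type /itp /forb; case: t; last first.
- apply: eq_forallb => s; rewrite card_sblock.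
  by case: #|_| => [|[|k]] //; rewrite mulnS.
- by apply/esym/forallP.
by apply: eq_forallb => s; rewrite card_sblock; congr (_ ==> _); lia.
Qed.

Lemma itp_mg x r p : mvok x r (inr p) -> itp (mv x r (inr p)) = itp x.
Proof. by move=> ok; apply: eq_forallb => s; rewrite mv_scls. Qed.

Lemma itp_sg x r s : mvok x r (inl s) -> itp x ->
  itp (mv x r (inl s)) = [|| ~~ forb s, s \in signs x | #|rcls x r| != 1].
Proof.
move=> ok itx; case/andP: (ok) => rx _.
have rr : r \in rcls x r by rewrite clsE (cd_rep rx) eqxx.
have nr : r \notin scls x s by rewrite clsE (cd_rep rx).
have dis : #|scls x s :|: rcls x r| = #|scls x s| + #|rcls x r|.
  apply/eqP; rewrite (leq_card_setU _ _); apply/pred0P => i /=; rewrite !clsE.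
  by case: (cd x i) => [s'|[r' c]]; rewrite ?andbF.
have rc0 : 0 < #|rcls x r| by apply/card_gt0P; exists r.
apply/forallP/idP => [/(_ s)|H s'].
  rewrite mv_scls // eqxx dis signs_scls; case: (forb s) => //=; lia.
rewrite mv_scls //; case: (inl s =P inl s') => [[<-]|_]; last exact: (forallP itx).
move: H (forallP itx s); rewrite dis signs_scls; case: (forb s) => //=; lia.
Qed.

Lemma itpP x s : itp x -> forb s -> #|scls x s| != 1.
Proof. by move=> /forallP/(_ s)/implyP. Qed.

Opaque itp.

(** A representative [r] of [x] lost in [y] can be moved as [y] prescribes, unless this makes the
    class of a forbidden sign a single pair. Since [y] has the right type, that class has a further
    element in [y], whose representative in [x] can be merged with [r] instead. *)
Lemma move_le x y : itp x -> itp y -> lpart_le x y -> x <> y ->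
  exists r v, [/\ mvok x r v, itp (mv x r v) & lpart_le (mv x r v) y].
Proof.
move=> ix iy le ne; have /properP[sub [r rx ry]] := reps_proper le ne.
have /cd_leP lei := le.
case E: (cd y r) => [s|[r1 b]]; last first.
  have [le1 r1y] := cd_rootP E; have r1x := subsetP sub _ r1y.
  have lt1 : r1 < r.
    rewrite ltn_neqAle le1 andbT; apply: contra ry => /eqP/val_inj e.
    by rewrite -e.
  have ok : mvok x r (inr (r1, b)) by rewrite /mvok rx r1x.
  exists r, (inr (r1, b)); split; first exact: ok.
    by rewrite (itp_mg ok); exact: ix.
  by apply: (mv_le ok le); rewrite E /= (cd_rep r1y) /= addbF.
have ok : mvok x r (inl s) by rewrite /mvok rx.
have lez : lpart_le (mv x r (inl s)) y by apply: mv_le.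
have [iz|] := boolP (itp (mv x r (inl s))); first by exists r, (inl s).
rewrite itp_sg // !negb_or !negbK => /and3P[fs sx /cards1P[r0 er0]].
have {}er0 : rcls x r = [set r].
  have : r \in rcls x r by rewrite clsE (cd_rep rx) eqxx.
  by rewrite er0 clsE => /eqP->.
have := itpP iy fs.
rewrite (cardsD1 r) clsE E eqxx /= => nz.
have /card_gt0P[i] : 0 < #|scls y s :\ r| by rewrite lt0n; apply: contra nz => /eqP->.
rewrite !clsE => /andP[nir /eqP yi].
case Ei: (cd x i) => [s'|[r' c]].
  case/negP: sx; move: (lei i); rewrite Ei yi /= => -[->].
  by rewrite mem_signsE; apply/existsP; exists i; rewrite Ei.
have [_ r'x] := cd_rootP Ei.
have nr' : r' != r.
  apply: contra nir => /eqP er'; have : i \in rcls x r by rewrite clsE Ei er'.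
  by rewrite er0 clsE.
have yr' : cd y r' = inl s.
  apply/eqP; rewrite -(twist_inl c) -yi eq_sym.
  by rewrite (lei i) Ei.
(* Both representatives end in the block of sign [s] of [y], so merging them stays below [y]
   whatever the relative bar; [false] is an arbitrary choice. *)
have G r1 r2 : r1 \in reps x -> r2 \in reps x -> r1 < r2 ->
   cd y r1 = inl s -> cd y r2 = inl s ->
   exists r v, [/\ mvok x r v, itp (mv x r v) & lpart_le (mv x r v) y].
  move=> r1x r2x lt1 e1 e2.
  have ok' : mvok x r2 (inr (r1, false)) by rewrite /mvok r2x r1x.
  exists r2, (inr (r1, false)); split; first exact: ok'.
    by rewrite (itp_mg ok'); exact: ix.
  by apply: (mv_le ok' le); rewrite /= e1 e2.
case: (ltngtP r' r) => [lt1|lt1|/val_inj e]; [exact: G lt1 _ _|exact: G lt1 _ _|].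
by rewrite e eqxx in nr'.
Qed.

Lemma coversP x y : reflect
  (itp x /\ exists r v, [/\ mvok x r v, itp (mv x r v) & y = mv x r v])
  (covers t sbar (Some x) (Some y)).
Proof.
apply: (iffP and4P); rewrite !in_typeE.
  case=> ix iy /andP[/eqP ne le] nz; split; first by [].
  have {}ne : x <> y by move=> e; apply: ne; rewrite e.
  move: nz => /forall_inP.
  have [r [v [ok iz lez]]] := move_le ix iy le ne.
  move=> /(_ (Some (mv x r v))); rewrite in_typeE iz => /(_ isT) nz.
  exists r, v; split; [exact: ok|exact: iz|]; apply/eqP; apply: contraT.
  move=> /eqP nzy; case/negP: nz; apply/andP; split; apply/andP; split.
  - by apply/eqP => -[]; apply: mv_neq.
  - exact: mv_ge.
  - by apply/eqP => -[e]; apply: nzy.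
  - exact: lez.
case=> ix [r [v [ok iz ->]]]; split; [exact: ix|exact: iz| |].
  apply/andP; split; last exact: mv_ge.
  by apply/eqP => -[]; apply: mv_neq.
apply/forall_inP => -[z|] _; last by rewrite /lposet_lt /= ?andbF.
apply/negP => /andP[/andP[/eqP n1 l1] /andP[/eqP n2 l2]].
have {}n1 : x <> z by move=> e; apply: n1; rewrite e.
have {}n2 : z <> mv x r v by move=> e; apply: n2; rewrite e.
have := proper_card (reps_proper l1 n1).
have := proper_card (reps_proper l2 n2).
rewrite (card_mv_reps ok); lia.
Qed.

(** As long as a representative remains, some admissible move leads strictly between [x] and the
    maximum: reuse a sign present, merge two representatives, or, when one unsigned block fills
    [[n]], sign it with [sbar]. In type D the last move needs a block that is not a single pair,
    that is [1 < n]. *)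
Lemma covers_hat1 x : 0 < n -> (t <> TypeC -> 1 < n) ->
  covers t sbar (Some x) None = itp x && (reps x == set0).
Proof.
move=> n0 n1; rewrite /covers in_typeE /=; case ix: (itp x) => //=.
apply/idP/idP => [/forall_inP nz|/eqP rx]; last first.
  apply/forall_inP => -[z|] _; last by rewrite /lposet_lt /= ?andbF.
  rewrite /lposet_lt andbT; apply/negP => /andP[/eqP ne le].
  have {}ne : x <> z by move=> e; apply: ne; rewrite e.
  move: (reps_proper le ne).
  by rewrite rx properE sub0set andbF.
apply: contraT => /set0Pn[r rx].
have {nz}K r' v : mvok x r' v -> itp (mv x r' v) -> False.
  move=> ok iz; move: (nz (Some (mv x r' v))); rewrite in_typeE iz.
  move=> /(_ isT) /negP[]; rewrite /lposet_lt andbT; apply/andP; split.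
    by apply/eqP => -[]; apply: mv_neq.
  exact: mv_ge.
have oks s : mvok x r (inl s) by rewrite /mvok rx.
have [s0 s0x|S0] := pickP (mem (signs x)).
  exfalso; apply: (K r (inl s0)); first exact: oks.
  by rewrite (itp_sg (oks _) ix); apply/or3P; apply: Or32.
have G r1 r2 : r1 \in reps x -> r2 \in reps x -> r1 < r2 -> False.
  move=> r1x r2x lt1; have ok' : mvok x r2 (inr (r1, false)) by rewrite /mvok r2x r1x.
  by apply: (K _ _ ok'); rewrite (itp_mg ok'); exact: ix.
have U r' : r' \in reps x -> r' = r.
  move=> r'x; case: (ltngtP r' r) => [lt1|lt1|/val_inj//]; exfalso; exact: G lt1.
exfalso; apply: (K r (inl sbar)); first exact: oks.
rewrite (itp_sg (oks _) ix).
have -> : rcls x r = setT.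
  apply/setP => i; rewrite !clsE; case E: (cd x i) => [s|[r' c]].
    by move: (S0 s); rewrite /= mem_signsE => /existsP[]; exists i; rewrite E.
  by have [_ /U->] := cd_rootP E; rewrite eqxx.
rewrite cardsT card_ord; move: n1; rewrite /forb; case: t => n1.
- by rewrite eqxx.
- by [].
have {}n1 : 1 < n by apply: n1.
by apply/or3P; apply: Or33; move: n1; rewrite ltn_neqAle eq_sym => /andP[].
Qed.

End Types.
End Moves.

Global Opaque mv itp.

(** * Labels of moves *)

Section Labels.
Context {d : Order.disp_t} {n : nat} {Sigma : finOrderType d}.
Implicit Types (x y z : lpart n Sigma) (e : dbl n) (i j r : 'I_n) (s : Sigma).
Implicit Types (v : (Sigma + 'I_n * bool)%type).

Lemma rep_le (R : {set dbl n}) i b : (i, b) \in R -> rep R <= i.+1.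
Proof.
move=> ib; have {ib}Pi : ((i, false) \in R) || ((i, true) \in R).
  by case: b ib => ->; rewrite ?orbT.
rewrite /rep; have := mem_index_enum i.
elim: (index_enum _) => // j l IH; rewrite inE big_cons => /orP[/eqP<-|/IH le].
  by rewrite Pi geq_minl.
by case: ifP => // _; rewrite geq_min le orbT.
Qed.

Lemma rep_ge (R : {set dbl n}) k : k <= n.+1 ->
  (forall i b, (i, b) \in R -> k <= i.+1) -> k <= rep R.
Proof.
move=> kn H; rewrite /rep; apply: (big_ind (leq k)) => //.
  by move=> a b ka kb; rewrite leq_min ka.
by move=> i /orP[]; exact: H.
Qed.

Lemma ext_root x r b : r \in reps x -> ext (cd x) (r, b) = inr (r, b).
Proof. by move=> rx; rewrite /ext cd_rep //= addbF. Qed.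

Lemma rep_blk x r : r \in reps x -> rep (blk x (r, false)) = r.+1.
Proof.
move=> rx; apply/anti_leq; rewrite (rep_le (mem_blk_id _ _)) /=.
have [_ _ rmin] := ext_cd_unsigned (ext_root false rx).
by apply: rep_ge => [|i b /rmin //]; rewrite ltnS ltnW.
Qed.

Lemma normalized_blk x r : r \in reps x -> normalized (blk x (r, false)).
Proof.
by move=> rx; apply/existsP; exists r; rewrite rep_blk // eqxx mem_blk_id.
Qed.

Lemma unsigned_blk x r : r \in reps x -> unsigned x (blk x (r, false)).
Proof.
move=> rx; rewrite /unsigned blk_in.
by have [->] := ext_cd_unsigned (ext_root false rx).
Qed.

Lemma unsigned_norm x (R : {set dbl n}) : unsigned x R -> normalized R ->
  exists2 r, r \in reps x & R = blk x (r, false).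
Proof.
case/andP=> Rx Ru /existsP[i /andP[/eqP ri iR]].
have Ri := blkE Rx iR; exists i => //.
case E: (ext (cd x) (i, false)) => [s|[r b]].
  by move/eqP: E; rewrite ext_cd_sign Ri => /eqP e; rewrite e in Ru.
have [_ rb rmin] := ext_cd_unsigned E.
have le1 := rmin _ _ (mem_blk_id _ _).
rewrite Ri in rb; have := rep_le rb; rewrite -ri ltnS => le2.
have er : r = i by apply/val_inj/anti_leq; rewrite le1 le2.
by move: E; rewrite ext0 er clsE => E; rewrite E (cd_root_eq E).
Qed.

Lemma union_block y (R R' : {set dbl n}) e e' :
  R :|: R' \in blocks y -> e \in R -> e' \in R' ->
  ext (cd y) e = ext (cd y) e'.
Proof.
move=> U eR e'R; apply/eqP; rewrite ext_cd_eq.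
by rewrite !(blkE U) // clsE ?eR ?e'R ?orbT.
Qed.

Definition slab x s : nat :=
  if s \in signs x then #|[set u in signs x | (u <= s)%O]|
  else #|[set u | (u <= s)%O] :|: signs x|.

Definition mlab x r v : nat *l nat :=
  match v with
  | inl s => (1, slab x s)
  | inr (r1, b) => if b then (2, r1.+1) else (0, r.+1)
  end.

Lemma sign_labelE x s : sign_label x s = (1, slab x s).
Proof. by rewrite /sign_label /slab; case: ifP. Qed.

(** Among the representatives of [x] only [r] changes its value, so two unsigned blocks that
    coalesce are those of [r] and of the representative [r1] it is attached to. As [r1 < r], the
    maximum is [r] and the minimum is [r1], whichever pair is picked, and the relative bar tells
    coherent from non-coherent. *)
Lemma label_mv x r v : mvok x r v ->
  label (Some x) (Some (mv x r v)) = mlab x r v.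
Proof.
move=> ok; case/andP: (ok) => rx vx; set z := mv x r v.
have zr : cd z r = v := mv_root ok.
have zo p : p \in reps x -> p != r -> cd z p = inr (p, false).
  by move=> px np; rewrite /z cd_mv // mvcodeE (cd_rep px) (negbTE np).
have coh R R' : coherent x z R R' -> exists r1, v = inr (r1, false) /\
    maxn (rep R) (rep R') = r.+1.
  case/andP=> uR /and5P[uR' nR nR' ne U].
  have [p px eR] := unsigned_norm uR nR; have [p' p'x eR'] := unsigned_norm uR' nR'.
  have : ext (cd z) (p, false) = ext (cd z) (p', false).
    by apply: (union_block U); rewrite ?eR ?eR' mem_blk_id.
  have npp : p != p' by apply: contra ne; rewrite eR eR' => /eqP->.
  rewrite !ext0 eR eR' !rep_blk //.
  have [ep|np] := eqVneq p r.
    rewrite ep zr zo // -?ep 1?eq_sym // => ev; exists p'; split=> //.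
    by move: vx; rewrite ev => /andP[_]; rewrite -ep; clear; lia.
  have [ep'|np'] := eqVneq p' r.
    rewrite ep' zr zo // => ev; exists p; split=> //.
    by move: vx; rewrite -ev => /andP[_]; rewrite -ep'; clear; lia.
  by rewrite !zo // => -[e]; rewrite e eqxx in npp.
have ncoh R R' : noncoherent x z R R' -> exists r1, v = inr (r1, true) /\
    minn (rep R) (rep R') = r1.+1.
  case/andP=> uR /and5P[uR' nR nR' ne U].
  have [p px eR] := unsigned_norm uR nR; have [p' p'x eR'] := unsigned_norm uR' nR'.
  have : ext (cd z) (p, false) = ext (cd z) (p', true).
    by apply: (union_block U); rewrite ?mem_bar ?eR ?eR' mem_blk_id.
  have npp : p != p' by apply: contra ne; rewrite eR eR' => /eqP->.
  rewrite ext0 /ext eR eR' !rep_blk //=.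
  have [ep|np] := eqVneq p r.
    rewrite ep zr zo // -?ep 1?eq_sym // => ev; exists p'; split=> //.
    by move: vx; rewrite ev => /andP[_]; rewrite -ep; clear; lia.
  have [ep'|np'] := eqVneq p' r.
    rewrite ep' zr zo // => ev; exists p.
    have ev' : v = inr (p, true).
      by apply: (@twist_inj _ _ true); rewrite -ev.
    by split=> //; move: vx; rewrite ev' => /andP[_]; rewrite -ep'; clear; lia.
  by rewrite !zo // => -[e]; rewrite e eqxx in npp.
have U r1 b : v = inr (r1, b) ->
    blk x (r1, false) :|: blk x (r, b) = blk z (r1, false).
  move=> ev; move: vx; rewrite ev => /andP[r1x lt1].
  have nr1 : r1 != r by rewrite neq_ltn lt1.
  apply/setP => -[i c]; rewrite clsE !mem_blk_ext.
  rewrite /ext /= (cd_rep r1x) (cd_rep rx) (zo _ r1x nr1) /= ?addbF.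
  rewrite /z cd_mv // mvcodeE ev.
  case E: (cd x i) => [s|[r' a]] /=; first by [].
  have [->|nr'] := eqVneq r' r; last first.
    by rewrite orbC (_ : _ == _ = false) //; apply/eqP => -[/eqP]; rewrite (negbTE nr').
  rewrite /= (_ : inr _ == inr (r1, false) = false) /=; last first.
    by apply/eqP => -[/eqP]; rewrite eq_sym (negbTE nr1).
  by apply/eqP/eqP => -[e]; [rewrite -e|]; congr inr; congr pair;
     move: e; case: (c) (a) (b) => [] [] [].
rewrite /label; case: pickP => [[R R'] /= /coh[r1 [-> ->]] //|nco].
case: pickP => [[R R'] /= /ncoh[r1 [-> ->]] //|nnc].
case ev: v => [s|[r1 b]]; last first.
  have [r1x lt1] : r1 \in reps x /\ r1 < r by move: vx; rewrite ev => /andP[].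
  have nb : blk x (r1, false) != blk x (r, false).
    rewrite -ext_cd_eq !ext_root //.
    by apply/eqP => -[e]; rewrite e ltnn in lt1.
  case: b ev => ev.
    move: (nnc (blk x (r1, false), blk x (r, false))).
    rewrite /noncoherent /= !unsigned_blk ?normalized_blk // nb /=.
    rewrite bar_blk -[barE _]/(r, true) (U _ _ ev).
    by rewrite blk_in.
  move: (nco (blk x (r1, false), blk x (r, false))).
  rewrite /coherent /= !unsigned_blk ?normalized_blk // nb /=.
  by rewrite (U _ _ ev) blk_in.
have ps s' : (sblock x s' \proper sblock z s') = (s' == s).
  apply/properP/eqP => [[_ [e]]|->].
    rewrite !mem_sblock => ez ex.
    have : e.1 \in scls z s' by rewrite clsE.
    rewrite mv_scls // ev; case: eqP => [[//]|_]; by rewrite clsE (negbTE ex).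
  split; last by exists (r, false); rewrite mem_sblock /= ?zr ?ev // cd_rep.
  apply/subsetP => e; rewrite !mem_sblock => ex.
  have : e.1 \in scls z s by rewrite mv_scls // ev eqxx !clsE ex.
  by rewrite clsE.
case: pickP => [s' |/(_ s)]; rewrite ps ?eqxx // => /eqP->.
exact: sign_labelE.
Qed.

Lemma label_fst (x y : lposet n Sigma) : (label x y).1 <= 2.
Proof.
case: x y => [x|] [y|] //=; case: pickP => [//|_]; case: pickP => [//|_].
by case: pickP => [s|_]; rewrite ?sign_labelE.
Qed.

Lemma lexi_le (a b a' b' : nat) :
  (((a, b) : nat *l nat) <= (a', b'))%O = ((a < a') || ((a == a') && (b <= b')))%N.
Proof.
by rewrite lexi_pair !leEnat; case: (ltngtP a a').
Qed.

End Labels.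

(** * Counting decreasing chains *)

Lemma card_tupleS (T : finType) k (Q : pred (seq T)) :
  #|[set c : k.+1.-tuple T | Q c]| =
  \sum_(y : T) #|[set c : k.-tuple T | Q (y :: c)]|.
Proof.
rewrite -sum1dep_card; under [RHS]eq_bigr do rewrite -sum1dep_card.
rewrite (pair_big_dep xpredT) /=.
rewrite (reindex (fun p : T * k.-tuple T => cons_tuple p.1 p.2)) //.
exists (fun t : k.+1.-tuple T => (thead t, behead_tuple t)).
  by move=> [y c] _; congr pair; apply: val_inj.
by move=> c _; rewrite [RHS]tuple_eta; apply: val_inj.
Qed.

(** All maximal chains have the same length and the same first element, which allows a passage from
    bounded sequences to tuples, where a recursion on the length is available. *)
Lemma card_bseq_tuple (T : finType) N k (x : T) (Q : pred (seq T)) :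
  (forall c, Q c -> size c <= N) ->
  (forall c, Q c -> size c = k.+1 /\ head x c = x) ->
  #|[set c : N.-bseq T | Q c]| = #|[set c : k.-tuple T | Q (x :: c)]|.
Proof.
move=> QN Qk.
pose f (c : k.-tuple T) : N.-bseq T := insub_bseq N (x :: c).
have fE (c : k.-tuple T) : Q (x :: c) -> f c = x :: c :> seq T.
  by move=> /QN le; rewrite /f /insub_bseq insubdK.
rewrite -(card_in_imset (f := f)); last first.
  move=> c c'; rewrite !inE => qc qc' /(congr1 val).
  by rewrite /= !fE // => -[e]; apply: val_inj.
apply: eq_card => c; rewrite inE; apply/idP/imsetP => [qc|[c' qc' ->]].
  have [sz hd] := Qk _ qc; case E: (val c) sz hd qc => [//|y l] /= [sz] yx q.
  rewrite yx in E q.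
  have sz' : size l == k by apply/eqP.
  exists (Tuple sz'); first by rewrite inE.
  by apply: val_inj; rewrite E; apply/esym/(fE (Tuple sz')).
by move: qc'; rewrite inE => qc'; rewrite fE.
Qed.

Local Arguments label : simpl never.

Section Count.
Context {d : Order.disp_t} {n : nat} {Sigma : finOrderType d}.
Variables (t : root_type) (sbar : Sigma).
Hypotheses (n0 : 0 < n) (hBD : t <> TypeC -> 1 < n).
Local Notation T := (lposet n Sigma).
Local Notation lab := (nat *l nat)%type.
Implicit Types (x y z : lpart n Sigma) (r : 'I_n) (s : Sigma) (l : lab).

Definition dec_from (X : T) l (c : seq T) : bool :=
  [&& path (covers t sbar) X c, last X c == hat1 &
      path (fun a b : lab => (b <= a)%O) l (pairmap (@label d n Sigma) X c)].

Fixpoint cnt k (X : T) l : nat :=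
  if k is k'.+1 then
    \sum_(Y : T | covers t sbar X Y && (label X Y <= l)%O) cnt k' Y (label X Y)
  else X == hat1.

Lemma cntE k X l : #|[set c : k.-tuple T | dec_from X l c]| = cnt k X l.
Proof.
elim: k X l => [|k IH] X l.
  have -> : [set c : 0.-tuple T | dec_from X l c] =
            (if X == hat1 then setT else set0).
    apply/setP => c; rewrite inE (tuple0 c) /dec_from /= andbT.
    by case: (X == hat1); rewrite inE.
  by case: ifP => /= ->; rewrite ?cardsT ?card_tuple ?expn0 ?cards0.
rewrite card_tupleS /= [RHS]big_mkcond; apply: eq_bigr => Y _.
have E c : dec_from X l (Y :: c) =
    (covers t sbar X Y && (label X Y <= l)%O) && dec_from Y (label X Y) c.
  rewrite /dec_from /=; case: (covers t sbar X Y) => //=.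
  by case: (label X Y <= l)%O; rewrite ?andbF.
case: ifP => cond; last first.
  by apply/eqP; rewrite cards_eq0; apply/eqP/setP => c; rewrite !inE E cond.
by rewrite -IH; apply: eq_card => c; rewrite !inE E cond.
Qed.

Lemma covers_None (Y : T) : covers t sbar None Y = false.
Proof. by case: Y => [y|]; rewrite /covers /lposet_lt /= ?andbF. Qed.

Lemma size_path_hat1 x (c : seq T) : path (covers t sbar) (Some x) c ->
  last (Some x) c = hat1 -> size c = #|reps x|.+1.
Proof.
elim: c x => [//|[y|] c IH] x /= /andP[cov pc] lc.
  rewrite (IH _ pc lc); case/coversP: cov => ix [r [v [ok iz ->]]].
  by rewrite (card_mv_reps ok).
case: c pc lc {IH} => [_ _|Y c /=]; last by rewrite covers_None.
by move: cov; rewrite covers_hat1 // => /andP[_ /eqP->]; rewrite cards0.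
Qed.

Lemma reps0 : reps (@lpart0 n Sigma) = setT.
Proof.
apply/setP => i; rewrite mem_reps inE.
have H e : ext (cd (@lpart0 n Sigma)) e = inr e.
  case E: (ext _ e) => [s|[r b]].
    by move/eqP: E; rewrite ext_cd_sign /sign_of /= ffunE.
  have [_ rb _] := ext_cd_unsigned E.
  have : blk (@lpart0 n Sigma) e = [set e].
    by apply: blkE; rewrite ?inE // /blocks /= imset_f.
  by move=> be; move: rb; rewrite be inE => /eqP->.
by rewrite -(ext0 (cd _)) H eqxx.
Qed.

Lemma signs0 : signs (@lpart0 n Sigma) = set0.
Proof.
apply/setP => s; rewrite !inE; apply/existsP => -[R].
by rewrite /sign_of /= ffunE.
Qed.

Lemma itp_signs0 x : signs x = set0 -> itp t sbar x.
Proof.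
move=> S0; rewrite -in_typeE; case: (t) => //=; apply/forallP => s.
  rewrite card_sblock; have := signs_scls x s; rewrite S0 inE.
  by case: #|_| => //; rewrite implybT.
rewrite card_sblock; have := signs_scls x s; rewrite S0 inE.
by case: #|_|.
Qed.

(** Each move removes one representative and the step to the maximum comes last, so the number of
    steps is a function of [x]. *)
Definition cn x l : nat := cnt #|reps x|.+1 (Some x) l.

(** The bound [(3, 0)] exceeds every label, since first components are at most 2; it stands for the
    absence of a previous label. *)
Lemma card_chains :
  #|@decreasing_maximal_chains d n Sigma t sbar| = cn lpart0 (3, 0).
Proof.
rewrite /cn -cntE /decreasing_maximal_chains.
rewrite (@card_bseq_tuple T _ #|reps (@lpart0 n Sigma)|.+1 hat0
   (fun c => maximal_chain t sbar c && decreasing c)).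
- have E (c : seq T) : decreasing (hat0 :: c) =
      path (fun a b : lab => (b <= a)%O) (3, 0) (pairmap (@label d n Sigma) hat0 c).
    rewrite /decreasing; case: c => [//|y c] /=.
    case: (label _ y) (label_fst hat0 y) => a b /= le.
    have -> // : (((a, b) : lab) <= (3, 0))%O by rewrite lexi_le ltnS le.
  by apply: eq_card => c; rewrite !inE /dec_from E /maximal_chain eqxx /= -andbA.
- by move=> c /andP[/size_maximal_chain].
move=> [//|x c] /andP[/and3P[/eqP-> pc /eqP lc] _]; split=> //=.
by congr _.+1; exact: size_path_hat1.
Qed.

Lemma cn0 x l : itp t sbar x -> reps x = set0 -> cn x l = (((1, 2) : lab) <= l)%O.
Proof.
move=> ix r0; rewrite /cn /= big_mkcond (bigD1 None) //= big1 ?addn0.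
  by rewrite covers_hat1 // ix r0 eqxx cards0 /=; case: (_ <= l)%O.
move=> [y|//] _; case: ifP => // /andP[/coversP[_ [r [v [/andP[rx _] _ _]]]] _].
by rewrite r0 inE in rx.
Qed.

Lemma cnS x l : itp t sbar x -> reps x != set0 ->
  cn x l = \sum_(p : 'I_n * (Sigma + 'I_n * bool) |
      [&& mvok x p.1 p.2, itp t sbar (mv x p.1 p.2) & (mlab x p.1 p.2 <= l)%O])
      cn (mv x p.1 p.2) (mlab x p.1 p.2).
Proof.
move=> ix r0; rewrite /cn /=.
pose M := [set p : 'I_n * (Sigma + 'I_n * bool) |
      mvok x p.1 p.2 && itp t sbar (mv x p.1 p.2)].
pose f (p : 'I_n * (Sigma + 'I_n * bool)) : T := Some (mv x p.1 p.2).
rewrite (eq_bigl (fun Y => (Y \in f @: M) && (label (Some x) Y <= l)%O)).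
  rewrite big_imset_cond /=; last first.
    move=> [r v] [r' v']; rewrite !inE /= => /andP[ok _] /andP[ok' _] [].
    exact: mv_inj.
  apply: eq_big => [[r v]|[r v]]; rewrite inE /= -andbA.
    by case ok: (mvok x r v) => //=; rewrite /f label_mv.
  by case/and3P=> ok _ _; rewrite /f /= label_mv // (card_mv_reps ok).
move=> Y; congr (_ && _); apply/idP/imsetP => [|[[r v]]].
  case: Y => [y /coversP[_ [r [v [ok iz ->]]]]|]; last first.
    by rewrite covers_hat1 // (negbTE r0) andbF.
  by exists (r, v); rewrite // inE /= ok.
rewrite inE /= => /andP[ok iz] ->; apply/coversP; split; first exact: ix.
by exists r, v.
Qed.

End Count.

Global Opaque cn.

(** * Sign labels and binomial sums *)

Section SignLabels.
Context {d : Order.disp_t} {Sigma : finOrderType d}.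
Implicit Types (S : {set Sigma}) (s u : Sigma).

Definition slabs S s : nat :=
  if s \in S then #|[set u in S | (u <= s)%O]| else #|[set u | (u <= s)%O] :|: S|.

Definition rk s : nat := #|[set u : Sigma | (u < s)%O]|.

Lemma slabs_gt0 S s : 0 < slabs S s.
Proof.
by rewrite /slabs; case: ifP => sS; apply/card_gt0P; exists s; rewrite !inE ?sS lexx.
Qed.

Lemma slabs_max S s : slabs S s <= #|Sigma|.
Proof. by rewrite /slabs; case: ifP => _; apply: max_card. Qed.

Lemma slabs_in S s : (slabs S s <= #|S|) = (s \in S).
Proof.
rewrite /slabs; case: ifP => sS.
  by apply: subset_leq_card; apply/subsetP => u; rewrite inE => /andP[].
apply/negbTE; rewrite -ltnNge; apply: proper_card; apply/properP.
split; first exact: subsetUr.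
by exists s; rewrite ?sS // !inE lexx.
Qed.

(** By [slabs_in] the signs of [S] have labels at most [#|S|] and the others larger ones; within
    each of the two kinds the label increases strictly with the sign. *)
Lemma slabs_inj S : injective (slabs S).
Proof.
have lt_in s s' : (s < s')%O -> s \in S -> s' \in S -> slabs S s < slabs S s'.
  move=> lt sS s'S; rewrite /slabs sS s'S; apply: proper_card; apply/properP.
  split; last by exists s'; rewrite !inE s'S ?lexx //= -ltNge.
  by apply/subsetP => u; rewrite !inE => /andP[-> /= /le_trans]; apply; exact: ltW.
have lt_out s s' : (s < s')%O -> s \notin S -> s' \notin S -> slabs S s < slabs S s'.
  move=> lt sS s'S; rewrite /slabs (negbTE sS) (negbTE s'S).
  apply: proper_card; apply/properP.
  split; last by exists s'; rewrite !inE (negbTE s'S) ?lexx //= orbF -ltNge.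
  apply/subsetP => u; rewrite !inE => /orP[/le_trans le|->]; last by rewrite orbT.
  by rewrite le // ltW.
move=> s s' e; have SS : (s \in S) = (s' \in S) by rewrite -!slabs_in e.
case: (ltgtP s s') => // lt; exfalso.
  by case: (boolP (s \in S)) => sS; [have := lt_in _ _ lt sS|have := lt_out _ _ lt sS];
     rewrite -SS => /(_ sS); rewrite e ltnn.
by case: (boolP (s' \in S)) => sS; [have := lt_in _ _ lt sS|have := lt_out _ _ lt sS];
   rewrite SS => /(_ sS); rewrite e ltnn.
Qed.

(** The labels are [#|Sigma|] distinct numbers between 1 and [#|Sigma|], hence a permutation of that
    interval. *)
Lemma sum_slabs S (G : nat -> nat) a : a <= #|Sigma| ->
  \sum_(s | slabs S s <= a) G (slabs S s) = \sum_(1 <= b < a.+1) G b.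
Proof.
move=> am.
have U : uniq [seq slabs S s | s <- enum Sigma].
  by rewrite map_inj_uniq ?enum_uniq //; exact: slabs_inj.
have P : perm_eq [seq slabs S s | s <- enum Sigma] (iota 1 #|Sigma|).
  apply: uniq_perm; [exact: U|exact: iota_uniq|].
  have sub : {subset [seq slabs S s | s <- enum Sigma] <= iota 1 #|Sigma|}.
    move=> _ /mapP[s _ ->]; rewrite mem_iota slabs_gt0 /= add1n ltnS.
    exact: slabs_max.
  have [|_ //] := uniq_min_size U sub.
  by rewrite size_iota size_map -cardE.
transitivity (\sum_(b <- [seq slabs S s | s <- enum Sigma] | b <= a) G b).
  by rewrite big_map big_enum_cond.
rewrite (perm_big _ P) /= /index_iota subSS subn0.
rewrite -(subnKC am) iotaD big_cat /= [X in _ + X]big1_seq ?addn0.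
  by rewrite big_seq_cond [RHS]big_seq; apply: eq_bigl => b; rewrite mem_iota; lia.
by move=> b /andP[ba]; rewrite mem_iota => /andP[]; lia.
Qed.

Lemma slabs0 s : slabs set0 s = (rk s).+1.
Proof.
rewrite /slabs in_set0 setU0 /= /rk (cardsD1 s [set u | (u <= s)%O]).
rewrite inE lexx add1n; congr _.+1.
by apply: eq_card => u; rewrite !inE lt_neqAle.
Qed.

Lemma rk_inj : injective rk.
Proof. by move=> s s' e; apply: (@slabs_inj set0); rewrite !slabs0 e. Qed.

Definition below S : {set Sigma} := [set u | [forall s in S, (u < s)%O]].

Lemma below_notin S s : s \in below S -> s \notin S.
Proof.
rewrite inE => /forall_inP H; apply/negP => /H; by rewrite ltxx.
Qed.

Lemma rk_below S s : (rk s < #|below S|) = (s \in below S).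
Proof.
rewrite -slabs0 /slabs in_set0 setU0 /=; apply/idP/idP => [lt|sB]; last first.
  apply: subset_leq_card; apply/subsetP => u; rewrite !inE => us.
  apply/forall_inP => s' s'S; apply: le_lt_trans us _.
  by move: sB; rewrite inE => /forall_inP; apply.
apply: contraLR lt => sB; rewrite -ltnNge.
apply: proper_card; apply/properP; split; last by exists s; [rewrite inE lexx|exact: sB].
apply/subsetP => u; rewrite inE => /forall_inP uB; rewrite inE leNgt.
apply: contra sB => su; rewrite inE; apply/forall_inP => s' /uB; exact: lt_trans.
Qed.

Lemma sum_rk_below S (G : nat -> nat) :
  \sum_(s in below S) G (rk s) = \sum_(c < #|below S|) G c.
Proof.
rewrite (eq_bigl (fun s => slabs set0 s <= #|below S|)); last first.
  by move=> s; rewrite slabs0 rk_below.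
rewrite (eq_bigr (fun s => G (slabs set0 s).-1)); last by move=> s _; rewrite slabs0.
rewrite (sum_slabs _ (fun b => G b.-1)) ?max_card // big_add1 /=.
by rewrite big_mkord.
Qed.

(** The signs up to [s] are disjoint from [S]. With [below_setU1], the label of a newly opened [s]
    is [#|below (s |: S)| + #|s |: S|], so the bound keeps its shape along the induction. *)
Lemma slabs_below S s : s \in below S -> slabs S s = (rk s).+1 + #|S|.
Proof.
move=> sB; rewrite /slabs (negbTE (below_notin sB)) -slabs0 /slabs in_set0 setU0 /=.
apply/eqP; rewrite (leq_card_setU _ _); apply/pred0P => u /=; rewrite inE.
apply/negbTE/negP => /andP[us uS]; move: sB; rewrite inE => /forall_inP/(_ _ uS).
by rewrite ltNge us.
Qed.

(** A new sign that is not smaller than all of [S] has a label counting [below S], [S] and itself,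
    which is too many. This is what forces new signs to be opened in decreasing order. *)
Lemma slabs_out S s : s \notin S ->
  (slabs S s <= #|below S| + #|S|) = (s \in below S).
Proof.
move=> sS; case: (boolP (s \in below S)) => sB.
  by rewrite slabs_below // leq_add2r rk_below.
apply/negbTE; rewrite -ltnNge /slabs (negbTE sS).
have <- : #|below S :|: S| = #|below S| + #|S|.
  apply/eqP; rewrite (leq_card_setU _ _); apply/pred0P => u /=.
  by apply/negbTE/negP => /andP[/below_notin/negbTE->].
apply: proper_card; apply/properP; split; last first.
  by exists s; rewrite inE ?negb_or ?sB // inE lexx.
apply/subsetP => u; rewrite inE => /orP[uB|uS]; rewrite inE ?uS ?orbT //.
have := uB; rewrite -rk_below => /leq_trans; move/(_ (rk s)).
rewrite -rk_below -leqNgt in sB; move/(_ sB) => lt.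
rewrite inE leNgt; apply/orP; left; apply: contraL lt => su.
rewrite -leqNgt; apply: subset_leq_card; apply/subsetP => w; rewrite !inE => ws.
exact: lt_trans su.
Qed.

Lemma below_setU1 S s : s \in below S -> #|below (s |: S)| = rk s.
Proof.
move=> sB; apply: eq_card => u; rewrite !inE; apply/forall_inP/idP.
  by apply; rewrite !inE eqxx.
move=> us s'; rewrite !inE => /orP[/eqP->//|s'S].
by move: sB; rewrite inE => /forall_inP/(_ _ s'S); exact: lt_trans.
Qed.

Lemma below0 : #|below set0| = #|Sigma|.
Proof. by apply: eq_card => u; rewrite !inE; apply/forall_inP => s; rewrite inE. Qed.

End SignLabels.

(* The number of weakly decreasing sequences of length [k] in [{2, .., a}]. *)
Definition wdec (k a : nat) : nat := if 1 < a then 'C(k + a - 2, k) else 0.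

(** Here [b] is the first term of the sequence. The term [b = 1] vanishes even for [k = 0]:
    [wdec 0 a] is 1 exactly when the final label (1, 2) respects the bound [(1, a)]. *)
Lemma wdecS k a : wdec k.+1 a = \sum_(1 <= b < a.+1) wdec k b.
Proof.
elim: a => [|a IH]; first by rewrite big_nil.
rewrite big_nat_recr //= -IH /wdec; case: a {IH} => [|[|a]] //=.
  by rewrite !addn2 !subn2 /= !binn.
by rewrite !addnS !addSn !subn2 /= binS addnC.
Qed.

(** A sum over the subsets of [c] candidate signs, grouped by their size [q]; [pascalS] separates
    the subsets that avoid or contain one given candidate. *)
Definition pascal (c : nat) (f : nat -> nat) : nat := \sum_(q < c.+1) 'C(c, q) * f q.

Lemma pascalS c f : pascal c.+1 f = pascal c f + pascal c (f \o succn).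
Proof.
rewrite /pascal big_ord_recl /= bin0.
under eq_bigr do rewrite /= binS mulnDl.
rewrite big_split /= addnA; congr (_ + _).
rewrite [RHS]big_ord_recl bin0 [in LHS]big_ord_recr /= bin_small //.
by rewrite mul0n addn0.
Qed.

Lemma pascalD c f g : pascal c (fun q => f q + g q) = pascal c f + pascal c g.
Proof. by rewrite /pascal -big_split; apply: eq_bigr => q _; rewrite mulnDr. Qed.

Lemma pascalZ c a f : pascal c (fun q => a * f q) = a * pascal c f.
Proof. by rewrite /pascal big_distrr; apply: eq_bigr => q _; rewrite mulnCA. Qed.

Lemma eq_pascal c f g : f =1 g -> pascal c f = pascal c g.
Proof. by move=> e; apply: eq_bigr => q _; rewrite e. Qed.

Section SignPhase.
Variable (beta : option nat).

(* [k] unsigned blocks, [s] of them non-singletons, [q] new signs to come and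
   [j] signs present: [pterm] counts the continuations whose [q] new signs are
   opened by non-singletons, [pterm1] those with [q] such signs and one more
   sign, opened by any block. *)
Definition pterm j k s q : nat := s ^_ q * ((k - q)`! * wdec (k - q) (j + q)).
Definition pterm1 j k s q : nat :=
  s ^_ q * (k - q) * ((k - q.+1)`! * wdec (k - q.+1) (j + q.+1)).

(** There are [c] candidates, the signs smaller than all signs present, and [beta] is the rank of
    the sign that any block may open, so [b < c] means that this sign is still a candidate. Then the
    new signs among the [c.-1] others are chosen, and the exceptional one is left closed or opened.
    The order of the chosen signs is forced, so only subsets are counted. *)
Definition psum c j k s : nat :=
  if (if beta is Some b then b < c else false) then
    pascal c.-1 (pterm j k s) + pascal c.-1 (pterm1 j k s)
  else pascal c (pterm j k s).

Lemma ptermS j k s q : pterm j k s q.+1 = s * pterm j.+1 k.-1 s.-1 q.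
Proof.
have e : k.-1 - q = k - q.+1 by lia.
by rewrite /pterm ffactnS -mulnA e addSnnS.
Qed.

Lemma pterm1S j k s q : pterm1 j k s q.+1 = s * pterm1 j.+1 k.-1 s.-1 q.
Proof.
have e : k.-1 - q = k - q.+1 by lia.
have e' : k.-1 - q.+1 = k - q.+2 by lia.
by rewrite /pterm1 ffactnS -!mulnA e e' addSnnS.
Qed.

(** The exceptional sign is opened first, by a non-singleton or by a singleton. The total, [s ^_ q]
    times [k - q], is the number of choices when the other [q] signs take their blocks first, so its
    place in the order does not affect the count. *)
Lemma pterm_any j k s q : s <= k ->
  s * pterm j.+1 k.-1 s.-1 q + (k - s) * pterm j.+1 k.-1 s q = pterm1 j k s q.
Proof.
move=> sk; have e : k.-1 - q = k - q.+1 by lia.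
rewrite /pterm /pterm1 e addSnnS; set X := _`! * wdec _ _.
rewrite mulnA -ffactnS [(k - s) * _]mulnA -mulnDl; congr (_ * _).
rewrite ffactnSr; have [qs|lt] := leqP q s; last by rewrite ffact_small ?mul0n ?muln0.
by rewrite [(k - s) * _]mulnC -mulnDr; congr (_ * _); lia.
Qed.

(** The candidate of rank [c], the largest of [c.+1], stays closed or is opened first; in the latter
    case the [c] smaller ones remain. A singleton may open it only if it is the exceptional sign. *)
Lemma psumS c j k s : s <= k ->
  psum c.+1 j k s = psum c j k s + (s * psum c j.+1 k.-1 s.-1 +
    (if beta == Some c then (k - s) * psum c j.+1 k.-1 s else 0)).
Proof.
move=> sk; rewrite /psum.
have PS a b : pascal c.+1 (pterm a b s) = pascal c (pterm a b s) +
    s * pascal c (pterm a.+1 b.-1 s.-1).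
  by rewrite pascalS -pascalZ; congr (_ + _); apply: eq_pascal => q; exact: ptermS.
case: beta => [b|]; last by rewrite PS addn0.
rewrite ltnS leq_eqVlt.
have -> : (Some b == Some c) = (b == c) by apply/eqP/eqP => [[]|->].
case: eqP => [->|ne] /=.
  rewrite ltnn -!pascalZ -!pascalD; apply: eq_pascal => q.
  by rewrite pterm_any.
case: ltnP => [lt|_]; last by rewrite PS addn0.
case: c lt ne PS => [//|c] lt ne PS /=; rewrite addn0 !pascalS mulnDr -!pascalZ.
rewrite addnACA; congr (_ + (_ + _)); apply: eq_pascal => q /=;
  [exact: ptermS|exact: pterm1S].
Qed.

Lemma psumE c j k s : s <= k ->
  psum c j k s = k`! * wdec k j + \sum_(c' < c)
   (s * psum c' j.+1 k.-1 s.-1 +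
    (if beta == Some (c' : nat) then (k - s) * psum c' j.+1 k.-1 s else 0)).
Proof.
move=> sk; elim: c => [|c IH]; last by rewrite psumS // IH big_ord_recr /= -addnA.
rewrite big_ord0 addn0 /psum; case: beta => [b|];
by rewrite /= /pascal big_ord1 /pterm /= ffactn0 !mul1n subn0 addn0.
Qed.

End SignPhase.

(** * The signing phase *)

Section Phases.
Context {d : Order.disp_t} {n : nat} {Sigma : finOrderType d}.
Variables (t : root_type) (sbar : Sigma).
Hypotheses (n0 : 0 < n) (hBD : t <> TypeC -> 1 < n).
Local Notation lab := (nat *l nat)%type.
Local Notation itp := (itp t sbar).
Local Notation cn := (@cn d n Sigma t sbar).
Implicit Types (x y z : lpart n Sigma) (r : 'I_n) (s : Sigma) (l : lab).

Lemma slabE x s : slab x s = slabs (signs x) s.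
Proof. by []. Qed.

Lemma cn_split x l : itp x -> reps x != set0 -> cn x l =
  \sum_(r in reps x)
    \sum_(s | itp (mv x r (inl s)) && (((1, slab x s) : lab) <= l)%O)
       cn (mv x r (inl s)) (1, slab x s)
  + \sum_(r in reps x)
    \sum_(r1 in reps x | r1 < r)
      ((if (((2, r1.+1) : lab) <= l)%O
        then cn (mv x r (inr (r1, true))) (2, r1.+1) else 0)
       + (if (((0, r.+1) : lab) <= l)%O
          then cn (mv x r (inr (r1, false))) (0, r.+1) else 0)).
Proof.
move=> ix rx0; rewrite (cnS n0 hBD) // -big_split /=.
pose Q r (v : (Sigma + 'I_n * bool)%type) :=
  (if v is inr (r1, _) then (r1 \in reps x) && (r1 < r) else true)
  && (itp (mv x r v) && (mlab x r v <= l)%O).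
rewrite (eq_bigl (fun p => (p.1 \in reps x) && Q p.1 p.2)); last first.
  by move=> [r v]; rewrite /mvok /Q /= -!andbA.
rewrite -(pair_big_dep (mem (reps x)) Q (fun r v => cn (mv x r v) (mlab x r v))) /=.
apply: eq_bigr => r rx; rewrite big_sumType /=; congr (_ + _).
transitivity (\sum_r1 \sum_(b : bool) if Q r (inr (r1, b)) then
   cn (mv x r (inr (r1, b))) (mlab x r (inr (r1, b))) else 0).
  by rewrite pair_bigA big_mkcond /=; apply: eq_bigr => -[r1 b] _.
rewrite [RHS]big_mkcond; apply: eq_bigr => r1 _; rewrite big_bool /Q /=.
case C: ((r1 \in reps x) && (r1 < r)) => /=; last by [].
case/andP: C => r1x lt.
have ok b : mvok x r (inr (r1, b)) by rewrite /mvok rx r1x.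
by rewrite !(itp_mg t sbar (ok _)) ix.
Qed.

Lemma itp_mv_mg x r r1 b : itp x -> r \in reps x -> r1 \in reps x -> r1 < r ->
  mvok x r (inr (r1, b)) /\ itp (mv x r (inr (r1, b))).
Proof.
move=> ix rx r1x lt; have ok : mvok x r (inr (r1, b)) by rewrite /mvok rx r1x.
by split; [exact: ok|rewrite (itp_mg t sbar ok); exact: ix].
Qed.

(** Every chain ends with the label (1, 2), which no bound [(0, b)] allows. Coherent merges are
    thereby excluded from decreasing chains. *)
Lemma cn_label0 x b : itp x -> cn x (0, b) = 0.
Proof.
move Ek: #|reps x| => k; elim: k x b Ek => [|k IH] x b Ek ix.
  have r0 : reps x = set0 by apply/eqP; rewrite -cards_eq0 Ek.
  by rewrite (cn0 n0 hBD) // lexi_le.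
have r0 : reps x != set0 by rewrite -cards_eq0 Ek.
rewrite cn_split // big1 => [|r rx]; last first.
  by rewrite big_pred0 // => s; rewrite lexi_le andbF.
rewrite big1 // => r rx; rewrite big1 // => r1 /andP[r1x lt].
have [ok iz] := itp_mv_mg false ix rx r1x lt.
have := card_mv_reps ok; rewrite Ek => -[/esym Ez].
by rewrite lexi_le /= IH //; case: ifP.
Qed.

Lemma cn_label1 x a : itp x -> reps x != set0 -> cn x (1, a) =
  \sum_(r in reps x) \sum_(s | itp (mv x r (inl s)) && (slab x s <= a))
     cn (mv x r (inl s)) (1, slab x s).
Proof.
move=> ix r0; rewrite cn_split // [X in _ + X]big1 ?addn0 => [|r rx]; last first.
  rewrite big1 // => r1 /andP[r1x lt].
  have [ok iz] := itp_mv_mg false ix rx r1x lt.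
  by rewrite !lexi_le /= cn_label0.
by apply: eq_bigr => r rx; apply: eq_bigl => s; rewrite lexi_le.
Qed.

Lemma cn_label2 x a : itp x -> reps x != set0 -> cn x (2, a) =
  cn x (1, #|Sigma|) +
  \sum_(r in reps x) \sum_(r1 in reps x | r1 < r)
    (if r1 < a then cn (mv x r (inr (r1, true))) (2, r1.+1) else 0).
Proof.
move=> ix r0; rewrite cn_split // cn_label1 //; congr (_ + _).
  apply: eq_bigr => r rx; apply: eq_bigl => s.
  by rewrite lexi_le slabE slabs_max.
apply: eq_bigr => r rx; apply: eq_bigr => r1 /andP[r1x lt].
have [ok iz] := itp_mv_mg false ix rx r1x lt.
by rewrite !lexi_le /= cn_label0 // addn0.
Qed.

Lemma cn_top x : itp x -> reps x != set0 -> cn x (3, 0) = cn x (2, n).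
Proof.
move=> ix r0; rewrite (cn_split (3, 0) ix r0) (cn_split (2, n) ix r0).
congr (_ + _).
apply: eq_bigr => r rx; apply: eq_bigr => r1 _.
by rewrite !lexi_le /= ltn_ord.
Qed.

Lemma reps_gt0 x k : #|reps x| = k.+1 -> reps x != set0.
Proof. by move=> Ek; rewrite -cards_eq0 Ek. Qed.

Lemma mvok_sg x r s : r \in reps x -> mvok x r (inl s).
Proof. by move=> rx; rewrite /mvok rx. Qed.

(** Under either condition no admissible label meets a type restriction: type C has none, and labels
    up to [#|signs x|] belong to signs already present. The blocks then come in any order, and
    independently of it the labels form any weakly decreasing sequence. *)
Lemma cn_free x a : itp x -> a <= #|Sigma| -> (t = TypeC \/ a <= #|signs x|) ->
  cn x (1, a) = #|reps x|`! * wdec #|reps x| a.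
Proof.
move Ek: #|reps x| => k; elim: k x a Ek => [|k IH] x a Ek ix am ta.
  have r0 : reps x = set0 by apply/eqP; rewrite -cards_eq0 Ek.
  rewrite (cn0 n0 hBD) // lexi_le fact0 mul1n /wdec.
  by case: ltnP => //; rewrite add0n bin0.
rewrite cn_label1 ?(reps_gt0 Ek) //.
under eq_bigr => r rx.
  rewrite (eq_bigl (fun s => slabs (signs x) s <= a)); last first.
    move=> s; rewrite -slabE; case: (leqP (slab x s) a) => sa; rewrite ?andbF //.
    rewrite andbT (itp_sg (mvok_sg s rx) ix); case: ta => [->//|aS].
    by rewrite -slabs_in -slabE (leq_trans sa aS) orbT.
  rewrite (eq_bigr (fun s => k`! * wdec k (slabs (signs x) s))); last first.
    move=> s; rewrite -slabE => sa; have ok := mvok_sg s rx.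
    have := card_mv_reps ok; rewrite Ek => -[/esym Ez].
    apply: IH; first exact: Ez.
    - rewrite (itp_sg ok ix); case: ta => [->//|aS].
      by rewrite -slabs_in -slabE (leq_trans sa aS) orbT.
    - exact: leq_trans sa am.
    case: ta => [->|aS]; [by left|right].
    rewrite (mv_signs ok (erefl _)) (leq_trans (leq_trans sa aS)) //.
    by apply: subset_leq_card; exact: subsetUr.
  rewrite (sum_slabs _ (fun b => k`! * wdec k b)) // -big_distrr -wdecS.
  over.
by rewrite sum_nat_const Ek factS mulnA.
Qed.

Definition nsing x : nat := #|[set r in reps x | #|rcls x r| != 1]|.

Lemma nsing_le x : nsing x <= #|reps x|.
Proof. by apply: subset_leq_card; apply/subsetP => r; rewrite inE => /andP[]. Qed.

Lemma nsing_mv x r s : r \in reps x ->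
  nsing x = nsing (mv x r (inl s)) + (#|rcls x r| != 1).
Proof.
move=> rx; have ok := mvok_sg s rx.
rewrite /nsing (cardsD1 r) inE rx addnC; congr (_ + _).
apply: eq_card => r'; rewrite in_setD1 in_set [RHS]in_set (mv_reps ok) in_setD1.
case: (eqVneq r' r) => ne /=; first by [].
by rewrite (mv_rcls_sg ok (erefl _) ne).
Qed.

Definition brank : option nat := if t is TypeB then Some (rk sbar) else None.

(** The bound admits exactly the signs present and those in [below (signs x)]. Using a present sign
    ends the openings, as the next bound is at most [#|signs x|] and [cn_free] applies. The
    assumption with 2 serves the base case: without blocks left, the chain tests whether the bound
    is at least 2 whereas [psum] tests the number of signs, and the two agree once two signs are
    present. *)
Lemma cn_new x : t <> TypeC -> itp x -> 2 <= #|reps x| + #|signs x| ->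
  cn x (1, #|below (signs x)| + #|signs x|) =
  psum brank #|below (signs x)| #|signs x| #|reps x| (nsing x).
Proof.
move=> tC; move Ek: #|reps x| => k; elim: k x Ek => [|k IH] x Ek ix ge2.
  have r0 : reps x = set0 by apply/eqP; rewrite -cards_eq0 Ek.
  have ns0 : nsing x = 0 by have := nsing_le x; rewrite Ek leqn0 => /eqP.
  rewrite add0n in ge2.
  rewrite (cn0 n0 hBD) // lexi_le ns0 psumE // big1 => [|c _]; last first.
    by rewrite subnn !mul0n; case: ifP.
  by rewrite addn0 /wdec ge2 bin0 /= (leq_trans ge2) // leq_addl.
rewrite cn_label1 ?(reps_gt0 Ek) //.
set S := signs x; set c := #|below S|; set j := #|S|.
have -> : \sum_(r in reps x)
    \sum_(s | itp (mv x r (inl s)) && (slab x s <= c + j))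
      cn (mv x r (inl s)) (1, slab x s) =
  \sum_(r in reps x) (k`! * wdec k.+1 j +
    \sum_(s in below S) (if ~~ forb t sbar s || (#|rcls x r| != 1) then
       psum brank (rk s) j.+1 k (nsing x - (#|rcls x r| != 1)) else 0)).
  apply: eq_bigr => r rx; rewrite (bigID (mem S)) /=; congr (_ + _).
    rewrite (eq_bigl (fun s => slabs S s <= j)); last first.
      move=> s; rewrite slabs_in; case sS: (s \in S); rewrite ?andbF //.
      rewrite (itp_sg (mvok_sg s rx) ix) -/S sS orbT /= slabE -/S.
      by rewrite andbT (leq_trans _ (leq_addl c j)) // slabs_in.
    rewrite (eq_bigr (fun s => k`! * wdec k (slabs S s))); last first.
      move=> s sj; have ok := mvok_sg s rx.
      have sS : s \in S by rewrite -slabs_in.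
      have := card_mv_reps ok; rewrite Ek => -[Ez].
      rewrite slabE -/S Ez; apply: cn_free.
      - by rewrite (itp_sg ok ix) -/S sS orbT.
      - exact: slabs_max.
      right; rewrite (mv_signs ok (erefl _)) (leq_trans sj) //.
      by apply: subset_leq_card; exact: subsetUr.
    by rewrite (sum_slabs _ (fun b => k`! * wdec k b)) ?max_card // -big_distrr -wdecS.
  rewrite [LHS]big_mkcond [RHS]big_mkcond; apply: eq_bigr => s _.
  case sB: (s \in below S); last first.
    case: ifP => // /andP[/andP[_ sc] sS].
    by rewrite slabE slabs_out // sB in sc.
  have sS := below_notin sB; have ok := mvok_sg s rx.
  rewrite sS andbT slabE slabs_out // sB andbT (itp_sg ok ix) -/S (negbTE sS) /=.
  case: ifP => // cond.
  have := card_mv_reps ok; rewrite Ek => -[/esym Ez].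
  have Sz : signs (mv x r (inl s)) = s |: S by rewrite (mv_signs ok (erefl _)).
  have cS : #|s |: S| = j.+1 by rewrite cardsU1 sS.
  have iz : itp (mv x r (inl s)) by rewrite (itp_sg ok ix) -/S (negbTE sS).
  have g2 : 1 < k + #|signs (mv x r (inl s))|.
    by rewrite Sz cS; move: ge2; rewrite -/j addSnnS.
  have := IH _ Ez iz g2; rewrite Sz below_setU1 // cS slabs_below // addSnnS => ->.
  by rewrite (nsing_mv s rx) addnK.
rewrite big_split /= sum_nat_const Ek mulnA -factS exchange_big /=.
rewrite psumE ?Ek -?Ek ?nsing_le // Ek; congr (_ + _).
rewrite -(sum_rk_below S (fun c' => nsing x * psum brank c' j.+1 k (nsing x).-1 +
  (if brank == Some c' then (k.+1 - nsing x) * psum brank c' j.+1 k (nsing x) else 0))).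
apply: eq_bigr => s sB; rewrite (bigID (fun r => #|rcls x r| != 1)) /=; congr (_ + _).
  rewrite (eq_bigr (fun=> psum brank (rk s) j.+1 k (nsing x).-1)); last first.
    by move=> r /andP[_ ->]; rewrite orbT subn1.
  by rewrite sum_nat_cond_const; congr (_ * _); apply: eq_card => r; rewrite !inE.
have cs : #|[set r in reps x | ~~ (#|rcls x r| != 1)]| = k.+1 - nsing x.
  rewrite -Ek -(cardsID [set r | #|rcls x r| != 1] (reps x)) addnC.
  rewrite (_ : _ :&: _ = [set r in reps x | #|rcls x r| != 1]) ?addnK.
    by apply: eq_card => r; rewrite !in_set andbC.
  by apply/setP => r; rewrite !in_set.
have -> : (brank == Some (rk s)) = ~~ forb t sbar s.
  rewrite /brank /forb; case: (t) tC => //= _.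
  by rewrite negbK; apply/eqP/eqP => [[/rk_inj//]|->].
rewrite (eq_bigr (fun=> if ~~ forb t sbar s then
  psum brank (rk s) j.+1 k (nsing x) else 0)).
  rewrite sum_nat_cond_const cs; case: ifP => //; by rewrite muln0.
by move=> r /andP[_ /negbTE->]; rewrite orbF subn0.
Qed.

End Phases.

(** * Weights of plane forests *)

(* The number of increasing plane trees with [l] ordinary nodes and [p] further
   nodes, larger than all the others, that have to be leaves. *)
Definition gtree (l p : nat) : nat :=
  if l is l'.+1 then dfact (l'.*2.-1) * \prod_(i < p) (l'.*2.+1 + i) else p == 1.

(** The largest ordinary node has only constrained leaves as children. Either it has no child and
    joins the constrained leaves, or its first child is deleted, which can be any of [p] leaves. As
    for the product in [gtree], a plane tree on [l'.+1] nodes has [l'.*2.+1] slots for a new leaf,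
    and each constrained leaf adds one slot. *)
Lemma gtreeS l p : gtree l.+1 p = p * gtree l.+1 p.-1 + gtree l p.+1.
Proof.
case: l => [|l].
  rewrite /= !mul1n; case: p => [|p] /=; first by rewrite big_ord0.
  by rewrite big_ord_recr /= addn0 mulnC.
have E : dfact l.+1.*2.-1 = l.*2.+1 * dfact l.*2.-1 by rewrite doubleS; case: l.
rewrite /gtree E doubleS; move: (dfact _) => D.
rewrite [in X in _ + X]big_ord_recl addn0.
case: p => [|p]; first by rewrite !big_ord0; lia.
rewrite [in X in _ + X]big_ord_recl big_ord_recr /= /bump /=.
rewrite [X in _ + _ * (_ * (_ * X))](eq_bigr (fun i : 'I_p => l.*2.+3 + i)).
  by move: (\prod_(i < p) _) => P; nia.
by move=> i _; lia.
Qed.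

Section TreeWeights.
Context {n : nat}.
Implicit Types (U B : {set 'I_n}) (Q : {set {set 'I_n}}).

Definition lcount U a B : nat := #|[set i in B | (i \in U) && (i < a)]|.
Definition pcount U a B : nat := #|[set i in B | (i \in U) && (a <= i)]|.
(** [U] holds the representatives left; those with index at least [a] can no longer collect and are
    the constrained leaves of [gtree]. *)
Definition weight U a Q : nat := \prod_(B in Q) gtree (lcount U a B) (pcount U a B).

Lemma weight_notin U (A : 'I_n) Q : A \notin U -> weight U A.+1 Q = weight U A Q.
Proof.
move=> AU; apply: eq_bigr => B _; congr gtree; apply: eq_card => i; rewrite !inE;
  case: (eqVneq i A) => [->|ne]; rewrite ?(negbTE AU) ?andbF //;
  have {}ne : (i : nat) != A by []; congr [&& _, _ & _]; lia.
Qed.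

(** This is [gtreeS] in the block of [A]: lowering the threshold turns [A] into a constrained leaf,
    and removing [r] deletes one. The factors of the other blocks do not change. *)
Lemma weight_in U (A : 'I_n) Q : partition Q [set: 'I_n] -> A \in U ->
  weight U A.+1 Q = weight U A Q +
  \sum_(r in U | (A < r) && (pblock Q r == pblock Q A)) weight (U :\ r) A.+1 Q.
Proof.
case/and3P=> /eqP cov tI n0Q AU; set B0 := pblock Q A.
have AB0 : A \in B0 by rewrite mem_pblock cov.
have B0Q : B0 \in Q by apply: pblock_mem; rewrite cov.
have inB0 r : (pblock Q r == B0) = (r \in B0).
  apply/eqP/idP => [<-|rB]; first by rewrite mem_pblock cov.
  exact: def_pblock tI B0Q rB.
have other B i : B \in Q -> B != B0 -> i \in B0 -> i \notin B.
  move=> BQ ne iB0; apply: contra ne => iB.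
  by rewrite -(def_pblock tI BQ iB) -(def_pblock tI B0Q iB0).
pose R := \prod_(B in Q | B != B0) gtree (lcount U A.+1 B) (pcount U A.+1 B).
have W1 : weight U A.+1 Q = gtree (lcount U A.+1 B0) (pcount U A.+1 B0) * R.
  by rewrite /weight (bigD1 B0).
have W2 : weight U A Q = gtree (lcount U A B0) (pcount U A B0) * R.
  rewrite /weight (bigD1 B0) //=; congr (_ * _); apply: eq_bigr => B /andP[BQ ne].
  congr gtree; apply: eq_card => i; rewrite !inE;
  case: (eqVneq i A) => [->|neA]; rewrite ?(negbTE (other _ _ BQ ne AB0)) //;
  have {}neA : (i : nat) != A by []; congr [&& _, _ & _]; lia.
have l1 : lcount U A.+1 B0 = (lcount U A B0).+1.
  rewrite /lcount (cardsD1 A) !inE AB0 AU ltnSn add1n; congr _.+1.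
  apply: eq_card => i; rewrite !inE; case: (eqVneq i A) => [->|neA] /=.
    by rewrite ltnn !andbF.
  have {}neA : (i : nat) != A by []; congr [&& _, _ & _]; lia.
have p1 : pcount U A B0 = (pcount U A.+1 B0).+1.
  rewrite /pcount (cardsD1 A) !inE AB0 AU leqnn add1n; congr _.+1.
  apply: eq_card => i; rewrite !inE; case: (eqVneq i A) => [->|neA] /=.
    by rewrite ltnn !andbF.
  have {}neA : (i : nat) != A by []; congr [&& _, _ & _]; lia.
have W3 r : r \in U -> A < r -> r \in B0 ->
    weight (U :\ r) A.+1 Q =
    gtree (lcount U A.+1 B0) (pcount U A.+1 B0).-1 * R.
  move=> rU Ar rB0; rewrite /weight (bigD1 B0) //=; congr (_ * _).
    congr gtree.
      apply: eq_card => i; rewrite !inE; case: (eqVneq i r) => [->|//] /=.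
      by rewrite [r < _]ltnS leqNgt Ar !andbF.
    rewrite {2}/pcount (cardsD1 r) !inE rB0 rU Ar /=; apply: eq_card => i.
    by rewrite !inE; case: (i == r); rewrite ?andbF.
  apply: eq_bigr => B /andP[BQ ne].
  congr gtree; apply: eq_card => i; rewrite !inE;
  by case: (eqVneq i r) => [->|//]; rewrite (negbTE (other _ _ BQ ne rB0)).
rewrite (eq_bigr (fun=> gtree (lcount U A.+1 B0) (pcount U A.+1 B0).-1 * R)).
  rewrite sum_nat_cond_const W1 W2 l1 gtreeS p1 mulnDl addnC mulnA.
  congr (_ + _ * _ * _); apply: eq_card => i; rewrite !inE ?inB0.
  by case: (i \in U); case: (A < i); case: (i \in B0).
by move=> r /and3P[rU Ar]; rewrite inB0; exact: W3.
Qed.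

End TreeWeights.

(** * The merging phase *)

Section Underlying.
Context {n : nat} {Sigma : finType}.
Implicit Types (x y z : lpart n Sigma) (i r : 'I_n) (Q : {set {set 'I_n}}).

Definition rt x i : 'I_n := if cd x i is inr (r, _) then r else i.

Definition coarse x Q : bool := [forall i, pblock Q (rt x i) == pblock Q i].

Lemma rtE x i : signs x = set0 -> exists b, cd x i = inr (rt x i, b).
Proof.
move=> S0; rewrite /rt; case E: (cd x i) => [s|[r b]]; last by exists b.
have : s \in signs x by rewrite mem_signsE; apply/existsP; exists i; rewrite E.
by rewrite S0 inE.
Qed.

Lemma rt_in x i : signs x = set0 -> rt x i \in reps x.
Proof. by move=> /(rtE i)[b E]; exact: cd_root E. Qed.

Lemma rt_id x r : r \in reps x -> rt x r = r.
Proof. by move=> rx; rewrite /rt cd_rep. Qed.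

Lemma mem_rcls_rt x r i : signs x = set0 -> (i \in rcls x r) = (rt x i == r).
Proof. by move=> /(rtE i)[b E]; rewrite mem_rcls E. Qed.

Lemma rt_mv x r r1 b i : signs x = set0 -> mvok x r (inr (r1, b)) ->
  rt (mv x r (inr (r1, b))) i = if rt x i == r then r1 else rt x i.
Proof.
move=> S0 ok; have [c E] := rtE i S0.
by rewrite {1}/rt cd_mv // mvcodeE E; case: ifP.
Qed.

Lemma coarse_mv x r r1 b Q : signs x = set0 -> mvok x r (inr (r1, b)) ->
  coarse (mv x r (inr (r1, b))) Q = coarse x Q && (pblock Q r == pblock Q r1).
Proof.
move=> S0 ok; have /andP[rx /andP[r1x _]] := ok.
apply/forallP/andP => [H|[/forallP H /eqP e] i]; last first.
  rewrite rt_mv //; case: (rt x i =P r) => [er|_]; last exact: H.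
  by rewrite -e -er; exact: H.
have er : pblock Q r == pblock Q r1.
  by have := H r; rewrite rt_mv // rt_id // eqxx eq_sym.
split=> //; apply/forallP => i; have := H i; rewrite rt_mv //.
by case: (rt x i =P r) => [->|//]; rewrite (eqP er).
Qed.

Definition rparts x : {set {set 'I_n}} := [set rcls x r | r in reps x].

Lemma rcls_inj x : {in reps x &, injective (rcls x)}.
Proof.
move=> r r' rx r'x /setP/(_ r); rewrite !mem_rcls (cd_rep rx) eqxx.
by move=> /esym/eqP.
Qed.

Lemma rparts_partition x : signs x = set0 -> partition (rparts x) [set: 'I_n].
Proof.
move=> S0; apply/and3P; split.
- rewrite eqEsubset subsetT /=; apply/subsetP => i _.
  apply/bigcupP; exists (rcls x (rt x i)); last by rewrite mem_rcls_rt.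
  by apply: imset_f; exact: rt_in.
- apply/trivIsetP => _ _ /imsetP[r rx ->] /imsetP[r' r'x ->] ne.
  apply/pred0P => i /=; rewrite !mem_rcls_rt //.
  by apply: contraNF ne => /andP[/eqP-> /eqP->].
apply/imsetP => -[r rx /setP/(_ r)].
by rewrite in_set0 mem_rcls_rt // rt_id // eqxx.
Qed.

Lemma pblock_rparts x i : signs x = set0 -> pblock (rparts x) i = rcls x (rt x i).
Proof.
move=> S0; have /and3P[_ tI _] := rparts_partition S0.
by apply: (def_pblock tI); [apply: imset_f; exact: rt_in|rewrite mem_rcls_rt].
Qed.

Lemma rparts_coarse x : signs x = set0 -> coarse x (rparts x).
Proof.
move=> S0; apply/forallP => i; rewrite !pblock_rparts //.
by rewrite (rt_id (rt_in i S0)).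
Qed.

Lemma weight_rparts x : signs x = set0 -> weight (reps x) 0 (rparts x) = 1.
Proof.
move=> S0; apply: big1 => B /imsetP[r rx ->].
have -> : lcount (reps x) 0 (rcls x r) = 0.
  by apply/eqP; rewrite cards_eq0 -subset0; apply/subsetP => i; rewrite inE ltn0 !andbF.
have -> // : pcount (reps x) 0 (rcls x r) = 1.
apply/eqP/cards1P; exists r; apply/setP => i; rewrite in_set1 in_set andbT mem_rcls_rt //.
apply/andP/eqP => [[/eqP<- ix]|->]; first by rewrite rt_id.
by rewrite rt_id.
Qed.

(** At threshold 0 all representatives are constrained leaves, and [gtree 0 p] is nonzero only for
    [p = 1]. A nonzero weight thus means one representative per block, and a coarser partition with
    this property is [rparts x] itself. *)
Lemma weight_coarse0 x Q : signs x = set0 -> partition Q [set: 'I_n] ->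
  coarse x Q -> Q != rparts x -> weight (reps x) 0 Q = 0.
Proof.
move=> S0 pQ cQ ne; have /and3P[/eqP cov tI n0Q] := pQ.
apply/eqP; apply: contraNT ne => W; apply/eqP.
have U B : B \in Q -> exists2 r, r \in reps x & B = rcls x r.
  move=> BQ; move: W; rewrite /weight (bigD1 B) //= muln_eq0 negb_or => /andP[+ _].
  have -> : lcount (reps x) 0 B = 0.
    by apply/eqP; rewrite cards_eq0 -subset0; apply/subsetP => i; rewrite inE ltn0 !andbF.
  rewrite /= eqb0 negbK => /cards1P[r /setP E].
  have Er i : (i \in B) && (i \in reps x) = (i == r).
    by have := E i; rewrite in_set1 in_set andbT.
  have /andP[rB rx] : (r \in B) && (r \in reps x) by rewrite Er.
  exists r => //; apply/setP => i; rewrite mem_rcls_rt //.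
  have pi := eqP (forallP cQ i).
  apply/idP/eqP => [iB|ei].
    apply/eqP; rewrite -Er (rt_in _ S0) andbT.
    by rewrite -(def_pblock tI BQ iB) -pi mem_pblock cov.
  by rewrite -(def_pblock tI BQ rB) -ei pi mem_pblock cov.
apply/setP => B; apply/idP/imsetP => [/U[r rx ->]|[r rx ->]]; first by exists r.
have rc : r \in cover Q by rewrite cov.
have [r' r'x e] := U _ (pblock_mem rc).
have : r \in rcls x r' by rewrite -e mem_pblock.
by rewrite mem_rcls_rt // rt_id // => /eqP er; rewrite er -e pblock_mem.
Qed.

Lemma sum_coarse0 x (F : {set {set 'I_n}} -> nat) : signs x = set0 ->
  \sum_(Q | partition Q [set: 'I_n] && coarse x Q) weight (reps x) 0 Q * F Q =
  F (rparts x).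
Proof.
move=> S0; rewrite (bigD1 (rparts x)) /=; last first.
  by rewrite rparts_partition ?rparts_coarse.
rewrite weight_rparts // mul1n big1 ?addn0 // => Q /andP[/andP[pQ cQ] ne].
by rewrite weight_coarse0.
Qed.

Lemma card_rparts x : #|rparts x| = #|reps x|.
Proof. by rewrite card_in_imset //; exact: rcls_inj. Qed.

End Underlying.

Section MergePhase.
Context {d : Order.disp_t} {n : nat} {Sigma : finOrderType d}.
Variables (t : root_type) (sbar : Sigma).
Hypotheses (n0 : 0 < n) (hBD : t <> TypeC -> 1 < n).
Local Notation itp := (itp t sbar).
Local Notation cn := (@cn d n Sigma t sbar).
Implicit Types (x y z : lpart n Sigma) (r : 'I_n) (s : Sigma).

Definition nonsing (Q : {set {set 'I_n}}) : nat := #|[set B in Q | 2 <= #|B|]|.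

Lemma nonsing_rparts x : signs x = set0 -> nonsing (rparts x) = nsing x.
Proof.
move=> S0; rewrite /nonsing /nsing.
have -> : [set B in rparts x | 2 <= #|B|] =
    [set rcls x r | r in [set r in reps x | #|rcls x r| != 1]].
  apply/setP => B; rewrite inE; apply/andP/imsetP => [[/imsetP[r rx ->] c2]|[r]].
    by exists r; rewrite // inE rx neq_ltn c2 orbT.
  rewrite inE => /andP[rx c1] ->; split; first exact: imset_f.
  have : 0 < #|rcls x r|.
    by apply/card_gt0P; exists r; rewrite mem_rcls_rt // rt_id.
  by case: #|_| c1 => [|[]].
rewrite card_in_imset // => r r'; rewrite inE => /andP[rx _].
by rewrite inE => /andP[r'x _]; exact: rcls_inj.
Qed.

Lemma reps_signs0 x : signs x = set0 -> reps x != set0.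
Proof.
move=> S0; apply/set0Pn; exists (rt x (Ordinal n0)); exact: rt_in.
Qed.

Variable F : nat -> nat -> nat.
Hypothesis HF : forall x, signs x = set0 ->
  cn x (1, #|Sigma|) = F #|reps x| (nsing x).

(** The larger bound allows only one new kind of next step, a merge into [A]; the following bound is
    then still [(2, A.+1)], so that [A] may collect again. *)
Lemma cn_label2S x (A : 'I_n) : signs x = set0 ->
  cn x (2, A.+1) = cn x (2, A : nat) +
  (if A \in reps x then
     \sum_(r in reps x | A < r) cn (mv x r (inr (A, true))) (2, A.+1) else 0).
Proof.
move=> S0; have ix := itp_signs0 t sbar S0; have r0 := reps_signs0 S0.
rewrite !(cn_label2 n0 hBD) // -addnA; congr (_ + _).
have -> : (if A \in reps x then \sum_(r in reps x | A < r)
      cn (mv x r (inr (A, true))) (2, A.+1) else 0) =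
    \sum_(r in reps x) \sum_(r1 in reps x | r1 < r)
      (if r1 == A then cn (mv x r (inr (r1, true))) (2, r1.+1) else 0).
  case: ifP => Ax; last first.
    rewrite big1 // => r rx; rewrite big1 // => r1 /andP[r1x _].
    by case: eqP => // e; rewrite -e r1x in Ax.
  rewrite [LHS]big_mkcondr; apply: eq_bigr => r rx.
  rewrite -big_mkcondr /=; case: ifP => lt.
    rewrite (big_pred1 A) // => r1; case: (eqVneq r1 A) => [->|ne].
      by rewrite /= Ax lt eqxx.
    by rewrite /= (negbTE ne) andbF.
  rewrite big_pred0 // => r1; case: (eqVneq r1 A) => [->|_]; last by rewrite andbF.
  by rewrite lt andbF.
rewrite -big_split; apply: eq_bigr => r rx; rewrite -big_split.
apply: eq_bigr => r1 _ /=; rewrite ltnS leq_eqVlt.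
have -> : (r1 == A) = (r1 == A :> nat) by [].
by case: eqP => [->|_] /=; rewrite ?ltnn ?add0n ?addn0.
Qed.

(** Completions are sorted by the partition [Q] of [[n]] underlying the element at which merging
    stops; by [HF] what follows depends only on the numbers of blocks and non-singletons of [Q].
    Relative bars offer no choice, since every merge is non-coherent. *)
Lemma cn_merge x a : signs x = set0 -> a <= n ->
  cn x (2, a) = \sum_(Q | partition Q [set: 'I_n] && coarse x Q)
     weight (reps x) a Q * F #|Q| (nonsing Q).
Proof.
elim: a x => [|a IHa] x S0 an.
  rewrite (sum_coarse0 (fun Q => F #|Q| (nonsing Q))) // card_rparts nonsing_rparts //.
  rewrite (cn_label2 n0 hBD) ?itp_signs0 ?reps_signs0 // HF // big1 ?addn0 // => r _.
  by rewrite big1.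
pose A := Ordinal an; rewrite -[a.+1]/(A.+1).
(* A second induction inside the one on [a]: a merge into [A] keeps the bound but loses a
   representative. *)
move Ek: #|reps x| => k; elim: k x Ek S0 => [|k IHk] x Ek S0.
  by have := reps_signs0 S0; rewrite -cards_eq0 Ek.
rewrite cn_label2S // IHa ?(ltnW an) //; case: ifP => Ax; last first.
  rewrite addn0; apply: eq_bigr => Q _; congr (_ * _).
  by rewrite -[a]/(A : nat) weight_notin // Ax.
have IHz r : r \in reps x -> A < r ->
    cn (mv x r (inr (A, true))) (2, A.+1) =
    \sum_(Q | partition Q [set: 'I_n] && coarse x Q)
      (if pblock Q r == pblock Q A then weight (reps x :\ r) A.+1 Q else 0)
      * F #|Q| (nonsing Q).
  move=> rx lt; have ok : mvok x r (inr (A, true)) by rewrite /mvok rx Ax lt.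
  have := card_mv_reps ok; rewrite Ek => -[/esym Ez].
  rewrite IHk //; last by rewrite (mv_signs_mg ok (erefl _)).
  rewrite [LHS]big_mkcond [RHS]big_mkcond; apply: eq_bigr => Q _.
  rewrite coarse_mv // andbA (mv_reps ok).
  by case: (_ && coarse x Q) => //=; case: (_ == _); rewrite ?mul0n.
under [X in _ + X]eq_bigr => r /andP[rx lt] do rewrite IHz //.
rewrite exchange_big -big_split /=; apply: eq_bigr => Q /andP[pQ cQ].
rewrite -big_distrl -mulnDl /=; congr (_ * _); rewrite -[a]/(A : nat).
rewrite (weight_in pQ Ax); congr (_ + _).
by rewrite -big_mkcondr /=; apply: eq_bigl => r; rewrite andbA.
Qed.

Lemma cn_start : cn lpart0 (2, n) = \sum_(Q | partition Q [set: 'I_n])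
   (\prod_(B in Q) dfactz (2 * #|B|%:Z - 3)%R) * F #|Q| (nonsing Q).
Proof.
rewrite cn_merge // ?signs0 // reps0.
have ct Q : coarse (@lpart0 n Sigma) Q.
  apply/forallP => i; rewrite rt_id // reps0 inE //.
apply: eq_big => [Q|Q /andP[pQ _]]; first by rewrite ct andbT.
congr (_ * _); apply: eq_bigr => B BQ.
have -> : lcount setT n B = #|B|.
  by apply: eq_card => i; rewrite !inE ltn_ord /= andbT.
have -> : pcount setT n B = 0.
  apply/eqP; rewrite cards_eq0 -subset0; apply/subsetP => i.
  by rewrite !inE leqNgt ltn_ord andbF.
have : 0 < #|B|.
  rewrite card_gt0; case/and3P: pQ => _ _; by apply: contraNneq => <-.
(* For a singleton [2 * 1 - 3] is negative, and the convention (-1)!! = 1 in [dfactz] agrees with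
   [gtree 1 0]. *)
case: #|B| => [//|[|m]] _; first by rewrite /= big_ord0.
rewrite /= big_ord0 muln1.
have -> : (2 * m.+2%:Z - 3 = (m.*2.+1)%:Z)%R by lia.
by [].
Qed.

End MergePhase.

(** * The closed formula *)

Section SignPhaseTotal.
Context {d : Order.disp_t} {n : nat} {Sigma : finOrderType d}.
Variables (t : root_type) (sbar : Sigma).
Hypotheses (n0 : 0 < n) (hBD : t <> TypeC -> 1 < n).

Definition sign_count (k s : nat) : nat :=
  if t is TypeC then k`! * wdec k #|Sigma|
  else if k == 1 then #|Sigma|.-1 else psum (brank t sbar) #|Sigma| 0 k s.

(** The only decision is the sign of the single block. Any sign is allowed because [1 < n], and the
    final label excludes just the sign of label 1. This is the origin of [f([n]) = m - 1]. *)
Lemma cn_single (x : lpart n Sigma) : 1 < n -> signs x = set0 -> #|reps x| = 1 ->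
  cn t sbar x (1, #|Sigma|) = #|Sigma|.-1.
Proof.
move=> n1 S0 /eqP/cards1P[r Er]; have ix := itp_signs0 t sbar S0.
rewrite (cn_label1 n0 hBD) ?reps_signs0 // Er big_set1.
have rx : r \in reps x by rewrite Er set11.
have cr : #|rcls x r| = n.
  rewrite -[RHS]card_ord; apply: eq_card => i; rewrite mem_rcls_rt // !inE.
  by have := rt_in i S0; rewrite Er inE.
rewrite (eq_bigl (fun s => slabs (signs x) s <= #|Sigma|)); last first.
  move=> s; rewrite slabE slabs_max andbT (itp_sg (mvok_sg s rx) ix) cr.
  by rewrite neq_ltn n1 !orbT.
rewrite (eq_bigr (fun s => (2 <= slabs (signs x) s : nat))); last first.
  move=> s _; have ok := mvok_sg s rx; rewrite (cn0 n0 hBD).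
  - by rewrite lexi_le slabE.
  - by rewrite (itp_sg ok ix) cr neq_ltn n1 !orbT.
  by rewrite (mv_reps ok) Er setDv.
rewrite (sum_slabs _ (fun b => (2 <= b : nat))) //.
case: #|Sigma| => [|m]; first by rewrite big_nil.
rewrite big_nat_recl //= add0n (eq_big_nat _ _ (F2 := fun=> 1)).
  by rewrite sum_nat_const_nat muln1 subn1.
by move=> i /andP[i1 _]; rewrite ltnS i1.
Qed.

Lemma sign_countE (x : lpart n Sigma) : signs x = set0 ->
  cn t sbar x (1, #|Sigma|) = sign_count #|reps x| (nsing x).
Proof.
move=> S0; have ix := itp_signs0 t sbar S0; rewrite /sign_count.
have rx : 0 < #|reps x| by rewrite card_gt0 reps_signs0.
have new : t <> TypeC -> cn t sbar x (1, #|Sigma|) =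
    if #|reps x| == 1 then #|Sigma|.-1
    else psum (brank t sbar) #|Sigma| 0 #|reps x| (nsing x).
  move=> tC; case: eqP => [r1|/eqP r1]; first by rewrite cn_single //; exact: hBD.
  have := cn_new n0 hBD tC ix; rewrite S0 below0 cards0 !addn0; apply.
  by rewrite ltn_neqAle eq_sym r1.
case et: t new => new; [exact: new| |exact: new].
by rewrite -et cn_free //; left.
Qed.

End SignPhaseTotal.

Local Open Scope ring_scope.

Lemma fact_rat_neq0 k : (k`!)%:R != 0 :> rat.
Proof. by rewrite pnatr_eq0 -lt0n fact_gt0. Qed.

Lemma wdec_rat k a : (1 < a)%N ->
  (k`! * wdec k a)%:R = ((k + a - 2)`!)%:R / ((a - 2)`!)%:R :> rat.
Proof.
move=> a1; rewrite /wdec a1; apply: (mulIf (fact_rat_neq0 (a - 2))).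
rewrite divfK ?fact_rat_neq0 // -natrM; congr (_%:R).
have le : (k <= k + a - 2)%N by lia.
have := bin_fact le; rewrite (_ : k + a - 2 - k = a - 2)%N; last by lia.
by rewrite mulnCA mulnA mulnC => <-; lia.
Qed.

Lemma ffact_rat s q : (q <= s)%N -> (s ^_ q)%:R = (s`!)%:R / ((s - q)`!)%:R :> rat.
Proof.
move=> qs; apply: (mulIf (fact_rat_neq0 (s - q))).
by rewrite divfK ?fact_rat_neq0 // -natrM ffact_fact.
Qed.

Lemma pterm_rat k s r : (2 <= r <= s)%N -> (s <= k)%N ->
  (pterm 0 k s r)%:R =
  ((k - 2)`!)%:R / ((r - 2)`!)%:R * ((s`!)%:R / ((s - r)`!)%:R) :> rat.
Proof.
move=> /andP[r2 rs] sk; rewrite /pterm add0n natrM wdec_rat // ffact_rat // mulrC.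
by rewrite (_ : k - r + r - 2 = k - 2)%N //; lia.
Qed.

(** Fewer than two open signs leave no label in {2, .., r}, and more than [s] new signs lack
    non-singletons to open them. The summation ranges of the theorem come from here. *)
Lemma pterm_out k s r : (r < 2)%N || (s < r)%N -> pterm 0 k s r = 0%N.
Proof.
case/orP=> lt; last by rewrite /pterm ffact_small.
by rewrite /pterm /wdec add0n ltnNge -ltnS lt /= muln0 muln0.
Qed.

Lemma pterm1_rat k s r : (1 <= r <= s)%N -> (s <= k)%N ->
  (pterm1 0 k s r)%:R =
  ((k - 2)`!)%:R / ((r.+1 - 2)`!)%:R * (k - r)%:R
    * ((s`!)%:R / ((s - r)`!)%:R) :> rat.
Proof.
move=> /andP[r1 rs] sk; rewrite /pterm1 add0n 2!natrM wdec_rat // ffact_rat //.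
(* For [k = r] the truncated differences would leave [k - 1] instead of [k - 2] under the factorial,
   but the factor [k - r] vanishes on both sides. *)
have [->|ne] := eqVneq k r; first by rewrite subnn !(mulr0, mul0r).
rewrite (_ : k - r.+1 + r.+1 - 2 = k - 2)%N; last by lia.
by ring.
Qed.

Lemma pterm1_out k s r : (r < 1)%N || (s < r)%N -> pterm1 0 k s r = 0%N.
Proof.
case/orP=> lt; last by rewrite /pterm1 ffact_small.
by rewrite /pterm1 /wdec add0n ltnNge -ltnS ltnS lt /= muln0 muln0.
Qed.

Lemma pascal_range c lo hi (f : nat -> nat) :
  (forall q, (q < lo)%N || (hi < q)%N -> f q = 0%N) ->
  (pascal c f)%:R = \sum_(lo <= q < (minn c hi).+1) 'C(c, q)%:R * (f q)%:R :> rat.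
Proof.
move=> f0; rewrite /pascal natr_sum.
under eq_bigr do rewrite natrM.
rewrite -(big_mkord xpredT (fun q => 'C(c, q)%:R * (f q)%:R)).
rewrite [RHS](big_nat_widen _ _ c.+1) ?ltnS ?geq_minl //.
rewrite [RHS](big_nat_widenl _ 0) // [RHS]big_mkcond; apply: eq_big_nat => q /andP[_ qc].
case: ifP => // cond; rewrite f0 ?mulr0 //.
by move: cond; rewrite ltnS leq_min; lia.
Qed.

Section FinalFormula.
Context {d : Order.disp_t} {n : nat} {Sigma : finOrderType d}.
Variables (t : root_type) (sbar : Sigma).
Implicit Types Q : {set {set 'I_n}}.

Lemma partition_one Q : (0 < n)%N -> partition Q [set: 'I_n] ->
  (Q == [set [set: 'I_n]]) = (#|Q| == 1%N).
Proof.
move=> n0 /and3P[/eqP cov _ _]; apply/eqP/cards1P => [->|[B EB]]; first by exists setT.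
by move: cov; rewrite EB cover1 => ->.
Qed.

Lemma fpartE Q : (0 < n)%N -> partition Q [set: 'I_n] ->
  fpart t #|Sigma| Q = (@sign_count d Sigma t sbar #|Q| (nonsing Q))%:R.
Proof.
move=> n0 pQ; have m0 : (0 < #|Sigma|)%N by apply/card_gt0P; exists sbar.
have Q0 : (0 < #|Q|)%N.
  case/and3P: pQ => /eqP cov _ _; rewrite card_gt0; apply: contraTneq n0 => e.
  have := cardsT 'I_n; rewrite -cov e /cover big_set0 cards0 card_ord.
  by move=> <-.
have sQ : (nonsing Q <= #|Q|)%N.
  by apply: subset_leq_card; apply/subsetP => B; rewrite inE => /andP[].
rewrite /fpart /sign_count /fC -/(nonsing Q) partition_one //.
move: (#|Q|) (nonsing Q) Q0 sQ => k s k0 sk.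
have m1 : #|Sigma|%:R - 1 = (#|Sigma|.-1)%:R :> rat.
  by rewrite -subn1 natrB.
case: t => /=.
- case: eqP => // /eqP k1; rewrite /psum /brank.
  have -> : (rk sbar < #|Sigma|)%N.
    by rewrite -below0 rk_below inE; apply/forall_inP => u; rewrite inE.
  (* [psum] puts first the chains in which [sbar] stays closed, [fB_sum] those in which it is
     opened. *)
  rewrite natrD addrC.
  rewrite (@pascal_range _ 1 s); last by move=> q; exact: pterm1_out.
  rewrite (@pascal_range _ 2 s); last by move=> q; exact: pterm_out.
  rewrite /fB_sum -!subn1; congr (_ + _).
    (* In this sum [r] counts [sbar] as well, so [r = q.+1] where [q] other signs are opened. *)
    case: #|Sigma| m0 => [//|m] _; rewrite minnSS subSS subn0 big_add1 /=.
    apply: eq_big_nat => r /andP[r1 rs]; rewrite pterm1_rat ?subSS ?subn0 ?mulrA //.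
    lia.
  apply: eq_big_nat => r /andP[r1 rs]; rewrite pterm_rat ?mulrA //; lia.
- case: eqP => [->|/eqP ne]; first by rewrite /wdec muln0.
  by rewrite wdec_rat // ltn_neqAle eq_sym ne.
case: eqP => // /eqP k1; rewrite /psum /brank.
rewrite (@pascal_range _ 2 s); last by move=> q; exact: pterm_out.
by apply: eq_big_nat => r /andP[r1 rs]; rewrite pterm_rat ?mulrA //; lia.
Qed.

End FinalFormula.

Theorem theorem5p2 (d : Order.disp_t) (Sigma : finOrderType d) (sbar : Sigma)
    (t : root_type) (n : nat) (hn : (1 <= n)%N)
    (hBD : t <> TypeC -> (2 <= n)%N) :
  #|@decreasing_maximal_chains d n Sigma t sbar|%:R =
  \sum_(p : {set {set 'I_n}} | partition p [set: 'I_n])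
     fpart t #|Sigma| p * \prod_(B in p) (dfactz (2 * #|B|%:Z - 3))%:R :> rat.
Proof.
have S0 := @signs0 d n Sigma; have ix := itp_signs0 t sbar S0.
rewrite (card_chains sbar hn hBD) (cn_top hn hBD ix) ?(reps_signs0 hn S0) //.
rewrite (cn_start hn hBD (sign_countE sbar hn hBD)) natr_sum.
apply: eq_bigr => Q pQ.
by rewrite natrM mulrC (fpartE t sbar hn pQ) natr_prod.
Qed.
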